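(* Let $G=(V,E)$ be a finite connected graph with set of oriented edges $A$ and cycle space $\mathcal C$, and let $\mathfrak m:A\to\mathbb R^d$ and $\phi:A\to(-\pi,\pi]$ be minimal forms on $G$ such that $\Phi_{\mathfrak m}(\mathcal C)=\mathbb Z^d$. Define $\mathscr A(\vartheta):\ell^2(V)\to\ell^2(V)$, $\vartheta\in\mathbb T^d$, by $$\big(\mathscr A(\vartheta)f\big)(v)=\varkappa_vf(v)-\sum_{\mathbf e=(v,u)\in A}e^{i(\phi(\mathbf e)+\langle\mathfrak m(\mathbf e),\vartheta\rangle)}f(u),\qquad v\in V.$$ Then there is a periodic graph $\mathcal G$ whose fundamental graph $G_*$ is isomorphic to $G$ such that $\mathscr A(\vartheta)$ is a fiber operator for the magnetic Laplacian $\Delta_\phi$ on $\mathcal G$ with the magnetic potential $\phi$.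
   Context: Finite graphs may have loops and multiple edges; each unoriented edge has two orientations, $\underline{\mathbf e}$ is the inverse of $\mathbf e$, $(v,u)$ denotes an oriented edge from $v$ to $u$, and $\varkappa_v$ is the number of oriented edges starting at $v$ (a loop contributes 2). A 1-form on $G$ is $\mathfrak b:A\to\mathbb R^n$ with $\mathfrak b(\underline{\mathbf e})=-\mathfrak b(\mathbf e)$. $\mathcal C$ is the (integral) cycle space, generated by closed edge paths. The flux is $\Phi_{\mathfrak b}(\mathbf c)=\sum_{\mathbf e\in\mathbf c}\mathfrak b(\mathbf e)$. A 1-form is minimal if its support has the least number of elements among all 1-forms (with values in the same $\mathbb R^n$) having the same flux function; for the form $\phi$, which plays the role of a magnetic form, fluxes are taken modulo $2\pi$. $\mathbb T^d=\mathbb R^d/(2\pi\mathbb Z)^d$, and $\langle\cdot,\cdot\rangle$ is the standard inner product of $\mathbb R^d$. A periodic graph $\mathcal G=(\mathcal V,\mathcal E)$, with set of oriented edges $\mathcal A$, is a connected infinite locally finite graph (loops and multiple edges allowed) embedded in $\mathbb R^d$, with $\mathcal G+a=\mathcal G$ for all $a$ in a rank $d$ lattice $\Gamma\subset\mathbb R^d$ with basis $a_1,\ldots,a_d$, and with finite quotient $G_*=\mathcal G/\Gamma=(\mathcal V_*,\mathcal E_* )$, the fundamental graph. $\mathcal V_*$ is identified with the vertices of $\mathcal G$ in the fundamental cell $\Omega=\{\sum_s t_sa_s:0\le t_s<1\}$. When $G_*\simeq G$, the form $\phi$ on $G$ lifts to a $\Gamma$-periodic magnetic potential $\phi:\mathcal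 A\to\mathbb R$, and $(\Delta_\phi f)(v)=\sum_{\mathbf e=(v,u)\in\mathcal A}(f(v)-e^{i\phi(\mathbf e)}f(u))$ on $\ell^2(\mathcal V)$. The family $\mathscr A(\vartheta)$ is a fiber operator for $\Delta_\phi$ if, after identifying $V$ with $\mathcal V_*$ by the graph isomorphism, $\mathscr U\Delta_\phi\mathscr U^{-1}=\int^\oplus_{\mathbb T^d}\mathscr A(\vartheta)\frac{d\vartheta}{(2\pi)^d}$ on $\mathscr H=L^2(\mathbb T^d,\frac{d\vartheta}{(2\pi)^d},\ell^2(\mathcal V_* ))$, where $\mathscr U=WU$, $U$ is the Gelfand transformation $(Uf)(\vartheta,v)=\sum_{n\in\mathbb Z^d}e^{-i\langle n,\vartheta\rangle}f(v+n_1a_1+\dots+n_da_d)$, and $W$ is a gauge transformation, i.e. multiplication by a function of $(\vartheta,v)\in\mathbb T^d\times\mathcal V_*$ of modulus one. *)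

(* Defs.v *)
From HB Require Import structures.
From mathcomp Require Import all_boot all_order all_algebra.
From mathcomp Require Import generic_quotient finmap.
From mathcomp Require Import all_classical all_reals all_analysis.
From mathcomp Require Import complex.
Set Implicit Arguments.
Unset Strict Implicit.
Unset Printing Implicit Defensive.
Import Order.TTheory GRing.Theory Num.Theory.
Import numFieldNormedType.Exports.
Local Open Scope classical_set_scope.
Local Open Scope ring_scope.
Local Open Scope quotient_scope.

(* Graphs with loops and multiple edges, given by their oriented edges.  An
   unoriented edge is a pair {e, ginv e}; the axiom ginv_neq gives loops two
   distinct orientations as well. *)
Record graph (V A : choiceType) := Graph {
  gsrc : A -> V;
  ginv : A -> A;
  ginvK : involutive ginv;
  ginv_neq : forall e, ginv e != e }.

Definition gtgt (V A : choiceType) (G : graph V A) (e : A) : V :=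
  gsrc G (ginv G e).

Fixpoint walk (V A : choiceType) (G : graph V A) (u : V) (p : seq A) (v : V)
    : Prop :=
  if p is e :: q then gsrc G e = u /\ walk G (gtgt G e) q v else u = v.

Definition connected_graph (V A : choiceType) (G : graph V A) : Prop :=
  forall u v, exists p, walk G u p v.

Record graph_iso (V A V' A' : choiceType) (G : graph V A) (G' : graph V' A') :=
  GraphIso {
    iso_v : V -> V';
    iso_vinv : V' -> V;
    iso_vK : cancel iso_v iso_vinv;
    iso_vinvK : cancel iso_vinv iso_v;
    iso_e : A -> A';
    iso_einv : A' -> A;
    iso_eK : cancel iso_e iso_einv;
    iso_einvK : cancel iso_einv iso_e;
    iso_src : forall e, gsrc G' (iso_e e) = iso_v (gsrc G e);
    iso_inv : forall e, ginv G' (iso_e e) = iso_e (ginv G e) }.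

Section CycleSpaceAndForms.
Variables (V A : finType) (G : graph V A).

(* An integral 1-chain is encoded as an antisymmetric integer function on the
   oriented edges, so that ginv e and - e are the same chain. *)
Definition chain (p : seq A) : {ffun A -> int} :=
  [ffun e => (count_mem e p)%:Z - (count_mem (ginv G e) p)%:Z].

Inductive cycle_space : {ffun A -> int} -> Prop :=
| cycle_closed v p : walk G v p v -> cycle_space (chain p)
| cycle_sub c c' : cycle_space c -> cycle_space c' -> cycle_space (c - c').

(* The sum over the oriented edges occurring in c, with multiplicity.  Each
   unoriented edge is counted only in the direction in which c runs through it,
   so this also makes sense for forms that are antisymmetric only modulo 2 pi. *)
Definition flux (M : zmodType) (b : A -> M) (c : {ffun A -> int}) : M :=
  \sum_(e | 0 < c e) b e *~ c e.

Definition form_support (M : zmodType) (b : A -> M) : {set A} :=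
  [set e | b e != 0]%SET.

(* eqv is the equality of values: Leibniz equality for vector-valued forms, and
   congruence modulo 2 pi for magnetic forms. *)
Definition one_form (M : zmodType) (eqv : M -> M -> Prop) (b : A -> M) : Prop :=
  forall e, eqv (b (ginv G e)) (- b e).

Definition minimal_form (M : zmodType) (eqv : M -> M -> Prop) (b : A -> M)
    : Prop :=
  one_form eqv b /\
  forall b' : A -> M, one_form eqv b' ->
    (forall c, cycle_space c -> eqv (flux b' c) (flux b c)) ->
    (#|form_support b| <= #|form_support b'|)%N.

End CycleSpaceAndForms.

Definition eq_mod2pi (R : realType) (x y : R) : Prop :=
  exists k : int, x = y + k%:~R * (2 * pi).

Section EmbeddedGraphs.
Variables (R : realType) (d : nat).

Definition int_vec (n : 'rV[int]_d) : 'rV[R]_d := map_mx intr n.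

(* A graph drawn in R^d and invariant under a lattice.  Vertices are pairwise
   distinct points and edges are pairwise distinct parametrized curves.  Curves
   may cross themselves and each other: for d <= 2 most periodic graphs have no
   drawing without crossings.  The lattice consists of the integral combinations
   n *m basis of the rows of basis; vshift n and eshift n are the action of such
   a translation on the drawing, and they are determined by it. *)
Record lattice_graph := LatticeGraph {
  lg_vert : choiceType;
  lg_edge : choiceType;
  lg_graph :> graph lg_vert lg_edge;
  lg_basis : 'M[R]_d;
  lg_basis_unit : lg_basis \in unitmx;
  lg_pos : lg_vert -> 'rV[R]_d;
  lg_pos_inj : injective lg_pos;
  lg_curve : lg_edge -> R -> 'rV[R]_d;
  lg_curve_continuous : forall e, {within `[0, 1], continuous (lg_curve e)};
  lg_curve_src : forall e, lg_curve e 0 = lg_pos (gsrc lg_graph e);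
  lg_curve_inv : forall e t, 0 <= t <= 1 ->
    lg_curve (ginv lg_graph e) t = lg_curve e (1 - t);
  lg_curve_inj : forall e e', (forall t, 0 <= t <= 1 ->
    lg_curve e t = lg_curve e' t) -> e = e';
  lg_vshift : 'rV[int]_d -> lg_vert -> lg_vert;
  lg_vshiftE : forall n v,
    lg_pos (lg_vshift n v) = lg_pos v + int_vec n *m lg_basis;
  lg_eshift : 'rV[int]_d -> lg_edge -> lg_edge;
  lg_eshiftE : forall n e t, 0 <= t <= 1 ->
    lg_curve (lg_eshift n e) t = lg_curve e t + int_vec n *m lg_basis;
  lg_connected : connected_graph lg_graph;
  lg_infinite : infinite_set [set: lg_vert];
  lg_locally_finite : forall v, finite_set [set e | gsrc lg_graph e = v] }.

Section Quotient.
Variable P : lattice_graph.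
Implicit Types (v w : lg_vert P) (e f : lg_edge P) (n : 'rV[int]_d).

Lemma int_vec0 : int_vec 0 = 0.
Proof. by rewrite /int_vec raddf0. Qed.

Lemma int_vecD n n' : int_vec (n + n') = int_vec n + int_vec n'.
Proof. by rewrite /int_vec raddfD. Qed.

Lemma vshift0 v : lg_vshift 0 v = v.
Proof. by apply: lg_pos_inj; rewrite lg_vshiftE int_vec0 mul0mx addr0. Qed.

Lemma vshiftD n n' v : lg_vshift n (lg_vshift n' v) = lg_vshift (n' + n) v.
Proof.
by apply: lg_pos_inj; rewrite !lg_vshiftE int_vecD mulmxDl addrA.
Qed.

Lemma eshift0 e : lg_eshift 0 e = e.
Proof.
by apply: lg_curve_inj => t t01; rewrite lg_eshiftE// int_vec0 mul0mx addr0.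
Qed.

Lemma eshiftD n n' e : lg_eshift n (lg_eshift n' e) = lg_eshift (n' + n) e.
Proof.
by apply: lg_curve_inj => t t01; rewrite !lg_eshiftE// int_vecD mulmxDl addrA.
Qed.

Lemma src_eshift n e : gsrc P (lg_eshift n e) = lg_vshift n (gsrc P e).
Proof.
apply: lg_pos_inj; rewrite lg_vshiftE -!lg_curve_src lg_eshiftE//.
by rewrite lexx ler01.
Qed.

Lemma inv_eshift n e : ginv P (lg_eshift n e) = lg_eshift n (ginv P e).
Proof.
apply: lg_curve_inj => t t01.
have t01' : 0 <= 1 - t <= 1.
  by case/andP: t01 => t0 t1; rewrite subr_ge0 t1 lerBlDr lerDl t0.
by rewrite lg_curve_inv// !lg_eshiftE// lg_curve_inv.
Qed.

Lemma vshift_fix n v : lg_vshift n v = v -> n = 0.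
Proof.
move=> /(congr1 (@lg_pos P)); rewrite lg_vshiftE => /eqP.
rewrite -subr_eq0 addrAC subrr add0r => /eqP nB0.
have : int_vec n = 0.
  by rewrite -(mulmxK (lg_basis_unit P) (int_vec n)) nB0 mul0mx.
move=> /matrixP n0; apply/matrixP => i j; rewrite mxE.
by have /eqP := n0 i j; rewrite !mxE intr_eq0 => /eqP.
Qed.

Definition same_vorbit v w : bool := `[< exists n, w = lg_vshift n v >].
Definition same_eorbit e f : bool := `[< exists n, f = lg_eshift n e >].

Lemma same_vorbit_refl : reflexive same_vorbit.
Proof. by move=> v; apply/asboolP; exists 0; rewrite vshift0. Qed.

Lemma same_vorbit_sym : symmetric same_vorbit.
Proof.
by move=> v w; apply/asboolP/asboolP => -[n ->]; exists (- n);
   rewrite vshiftD subrr vshift0.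
Qed.

Lemma same_vorbit_trans : transitive same_vorbit.
Proof.
move=> w v u /asboolP[n ->] /asboolP[n' ->]; apply/asboolP.
by exists (n + n'); rewrite vshiftD.
Qed.

Lemma same_eorbit_refl : reflexive same_eorbit.
Proof. by move=> e; apply/asboolP; exists 0; rewrite eshift0. Qed.

Lemma same_eorbit_sym : symmetric same_eorbit.
Proof.
by move=> e f; apply/asboolP/asboolP => -[n ->]; exists (- n);
   rewrite eshiftD subrr eshift0.
Qed.

Lemma same_eorbit_trans : transitive same_eorbit.
Proof.
move=> f e g /asboolP[n ->] /asboolP[n' ->]; apply/asboolP.
by exists (n + n'); rewrite eshiftD.
Qed.

Canonical vorbit_equiv :=
  EquivRel same_vorbit same_vorbit_refl same_vorbit_sym same_vorbit_trans.
Canonical eorbit_equiv :=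
  EquivRel same_eorbit same_eorbit_refl same_eorbit_sym same_eorbit_trans.

Definition fund_vert : choiceType := {eq_quot vorbit_equiv}.
Definition fund_edge : choiceType := {eq_quot eorbit_equiv}.

Definition vclass v : fund_vert := \pi_({eq_quot vorbit_equiv}) v.
Definition eclass e : fund_edge := \pi_({eq_quot eorbit_equiv}) e.
Definition vrepr (x : fund_vert) : lg_vert P :=
  repr (x : {eq_quot vorbit_equiv}).
Definition erepr (x : fund_edge) : lg_edge P :=
  repr (x : {eq_quot eorbit_equiv}).

Lemma vreprK x : vclass (vrepr x) = x.
Proof. exact: reprK. Qed.

Lemma ereprK x : eclass (erepr x) = x.
Proof. exact: reprK. Qed.

Lemma vclass_eq v w : vclass v = vclass w <-> exists n, w = lg_vshift n v.
Proof.
split; first by move=> /eqmodP/asboolP.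
by move=> vw; apply/eqmodP/asboolP.
Qed.

Lemma eclass_eq e f : eclass e = eclass f <-> exists n, f = lg_eshift n e.
Proof.
split; first by move=> /eqmodP/asboolP.
by move=> ef; apply/eqmodP/asboolP.
Qed.

Definition fund_src (x : fund_edge) : fund_vert := vclass (gsrc P (erepr x)).
Definition fund_inv (x : fund_edge) : fund_edge := eclass (ginv P (erepr x)).

Lemma fund_srcE e : fund_src (eclass e) = vclass (gsrc P e).
Proof.
have /eclass_eq[n en] := ereprK (eclass e).
by apply/vclass_eq; exists n; rewrite -src_eshift -en.
Qed.

Lemma fund_invE e : fund_inv (eclass e) = eclass (ginv P e).
Proof.
have /eclass_eq[n en] := ereprK (eclass e).
by apply/eclass_eq; exists n; rewrite -inv_eshift -en.
Qed.

Lemma fund_invK : involutive fund_inv.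
Proof. by move=> x; rewrite -(ereprK x) !fund_invE ginvK. Qed.

Lemma fund_inv_neq x : fund_inv x != x.
Proof.
rewrite -(ereprK x) fund_invE; set e := erepr x; apply/eqP => /eclass_eq[n en].
have n0 : n + n = 0.
  apply: (@vshift_fix _ (gsrc P (ginv P e))).
  by rewrite -vshiftD -src_eshift -en -{1}(ginvK P e) {2}en inv_eshift
             src_eshift.
have {}n0 : n = 0.
  apply/matrixP => i j; move/matrixP/(_ i j): n0; rewrite !mxE => /eqP.
  by rewrite -mulr2n mulrn_eq0/= => /eqP.
by have /eqP := ginv_neq P e; apply; rewrite [RHS]en n0 eshift0.
Qed.

Definition fundamental_graph : graph fund_vert fund_edge :=
  Graph fund_src fund_invK fund_inv_neq.


(* Translating v by minus the integer parts of its coordinates in the basis of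
   the lattice brings it into the fundamental cell, see cell_vertexP below. *)
Definition cell_vertex (x : fund_vert) : lg_vert P :=
  let v := vrepr x in
  lg_vshift (- map_mx Num.floor (lg_pos v *m invmx (lg_basis P))) v.

Definition fundamental_cell : set 'rV[R]_d :=
  [set t *m lg_basis P | t in [set t : 'rV[R]_d | forall i, 0 <= t 0 i < 1]].

Lemma cell_vertexP x v :
  (vclass v = x /\ fundamental_cell (lg_pos v)) <-> v = cell_vertex x.
Proof.
pose cellt (y : 'rV[R]_d) := y - map_mx intr (map_mx Num.floor y).
have cellt01 y i : 0 <= cellt y 0 i < 1.
  rewrite !mxE subr_ge0 floor_le/= ltrBlDl; have /andP[_] := floor_itv (y 0 i).
  by rewrite intrD1.
set w := vrepr x; set y := lg_pos w *m invmx (lg_basis P).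
have yw : y *m lg_basis P = lg_pos w by rewrite mulmxKV ?lg_basis_unit.
have cellE : lg_pos (cell_vertex x) = cellt y *m lg_basis P.
  rewrite /cell_vertex lg_vshiftE -/w -/y -{1}yw -mulmxDl; congr (_ *m _).
  by congr (_ + _); rewrite /int_vec raddfN.
have cellc : vclass (cell_vertex x) = x.
  rewrite -[RHS]vreprK; apply/esym/vclass_eq.
  by exists (- map_mx Num.floor y).
split=> [[vx [t /= t01 tv]]|->]; last first.
  by split=> //; rewrite cellE; exists (cellt y) => //= i; exact: cellt01.
have /vclass_eq[k ck] : vclass v = vclass (cell_vertex x) by rewrite cellc.
have tk : cellt y = t + int_vec k.
  apply: (can_inj (mulmxK (lg_basis_unit P))).
  by rewrite -cellE ck lg_vshiftE -tv mulmxDl.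
have k0 : k = 0.
  apply/matrixP => i j; rewrite ord1 [RHS]mxE {i}.
  have /andP[c0 c1] := cellt01 y j; have /andP[t0 t1] := t01 j.
  move: c0 c1; rewrite tk mxE [int_vec k 0 j]mxE => c0 c1.
  have k1 : (k 0 j < 1)%R.
    by rewrite -(ltr_int R); apply: le_lt_trans c1; rewrite lerDr.
  have k2 : (-1 < k 0 j)%R.
    rewrite -(ltr_int R) -subr_gt0 opprK addrC.
    by apply: le_lt_trans c0 _; rewrite ltrD2r.
  by move: k2; rewrite -lezD1 addNr => k2; apply/eqP; rewrite eq_le -ltzD1 k1.
by rewrite ck k0 vshift0.
Qed.

End Quotient.

Record periodic_graph := PeriodicGraph {
  pg_graph :> lattice_graph;
  pg_finite_vert : finite_set [set: fund_vert pg_graph];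
  pg_finite_edge : finite_set [set: fund_edge pg_graph] }.

End EmbeddedGraphs.

Definition cis (R : realType) (t : R) : R[i] := Complex (cos t) (sin t).

Definition sqmod (R : realType) (z : R[i]) : R :=
  complex.Re z ^+ 2 + complex.Im z ^+ 2.

Section TorusMeasure.
Variable R : realType.

Lemma lt0_2pi : 0 < 2 * pi :> R.
Proof. by rewrite mulr_gt0// pi_gt0. Qed.

(* uniform_prob lives on measurableTypeR R, whose measurable sets are those of R
   but under another display. *)
Definition circle_measure : set R -> \bar R := uniform_prob lt0_2pi.

Let circle_measure0 : circle_measure set0 = 0%E.
Proof. exact: measure0. Qed.

Let circle_measure_ge0 A : (0 <= circle_measure A)%E.
Proof. exact: measure_ge0. Qed.

Let circle_measure_sigma_additive : semi_sigma_additive circle_measure.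
Proof. exact: (@measure_semi_sigma_additive _ _ _ (uniform_prob lt0_2pi)). Qed.

HB.instance Definition _ := isMeasure.Build _ _ _ circle_measure
  circle_measure0 circle_measure_ge0 circle_measure_sigma_additive.

Let circle_measureT : circle_measure [set: R] = 1%:E.
Proof. exact: (@probability_setT _ _ _ (uniform_prob lt0_2pi)). Qed.

HB.instance Definition _ := Measure_isProbability.Build _ _ _
  circle_measure circle_measureT.

Definition tuple_cons (n : nat) (x : R * n.-tuple R) : n.+1.-tuple R :=
  [tuple of x.1 :: x.2].

Lemma measurable_tuple_cons n : measurable_fun setT (@tuple_cons n).
Proof. exact: measurable_cons. Qed.

HB.instance Definition _ n :=
  isMeasurableFun.Build _ _ _ _ (@tuple_cons n) (@measurable_tuple_cons n).

(* The torus R^d / (2 pi Z)^d with the measure d theta / (2 pi)^d is realized on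
   R^d by the product of d copies of the uniform probability on [0, 2 pi]. *)
Fixpoint torus_measure (d : nat) : probability (d.-tuple R) R :=
  if d is n.+1 then
    distribution (circle_measure \x torus_measure n)%E (@tuple_cons n)
  else \d_[tuple].

End TorusMeasure.

Section FiberOperators.
Variables (R : realType) (d : nat) (V : finType).
Local Notation C := R[i].
Local Notation mu := (torus_measure R d).
Implicit Types (g h : d.-tuple R -> V -> C) (theta : d.-tuple R).

Definition ell2 (X : choiceType) (f : X -> C) : Prop :=
  (\esum_(x in [set: X]) (sqmod (f x))%:E < +oo)%E.

Definition torus_sqnorm g : \bar R :=
  (\int[mu]_theta (\sum_(v : V) sqmod (g theta v))%:E)%E.

(* The elements of L^2(T^d; ell^2(V)) are represented by functions, two of which
   are the same element when they agree almost everywhere. *)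
Definition measurable_field g : Prop := forall v,
  measurable_fun setT (fun theta => complex.Re (g theta v)) /\
  measurable_fun setT (fun theta => complex.Im (g theta v)).

Definition torus_L2 g : Prop :=
  measurable_field g /\ (torus_sqnorm g < +oo)%E.

Definition torus_ae_eq g h : Prop :=
  {ae mu, forall theta, g theta = h theta}.

Definition inner_prod (x : 'rV[R]_d) theta : R :=
  \sum_(i < d) x 0 i * tnth theta i.

Section Gelfand.
Variables (P : periodic_graph R d) (cell : V -> lg_vert P).
Implicit Types f : lg_vert P -> C.

Definition gelfand_sum f (F : {fset 'rV[int]_d}) : d.-tuple R -> V -> C :=
  fun theta v => \sum_(n <- F)
    cis (- inner_prod (int_vec R n) theta) * f (lg_vshift n (cell v)).

(* h = U f: the series over Z^d defining U f converges unconditionally in L^2. *)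
Definition gelfand f h : Prop :=
  torus_L2 h /\
  forall eps : R, 0 < eps -> exists F0 : {fset 'rV[int]_d},
    forall F : {fset 'rV[int]_d}, (F0 `<=` F)%fset ->
      (torus_sqnorm (fun theta v => (gelfand_sum f F theta v - h theta v)%R)
        < eps%:E)%E.

Definition gauge (W : d.-tuple R -> V -> C) : Prop :=
  measurable_field W /\ forall theta v, sqmod (W theta v) = 1.

(* g = W U f for f in ell^2 of the vertices of P. *)
Definition gauged_gelfand (W : d.-tuple R -> V -> C) f g : Prop :=
  [/\ ell2 f, torus_L2 g &
    exists2 h, gelfand f h &
      torus_ae_eq g (fun theta v => W theta v * h theta v)].

(* The graph of a unitary operator from ell^2 onto L^2(T^d; ell^2(V)). *)
Definition unitary (U : (lg_vert P -> C) -> (d.-tuple R -> V -> C) -> Prop)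
    : Prop :=
  [/\ forall f, ell2 f -> exists g, U f g,
      forall f g g', U f g -> U f g' -> torus_ae_eq g g',
      forall f g, U f g ->
        torus_sqnorm g = \esum_(x in [set: lg_vert P]) (sqmod (f x))%:E &
      forall g, torus_L2 g -> exists f, U f g].

(* Af is a family of operators on ell^2(V) indexed by the torus, L an operator
   on ell^2 of the vertices of P.  The last clause says that
   U L U^-1 is the direct integral of Af: if f = U^-1 g, then U (L f) is the
   function theta |-> Af theta (g theta). *)
Definition fiber_operator (L : (lg_vert P -> C) -> (lg_vert P -> C))
    (Af : d.-tuple R -> (V -> C) -> (V -> C)) : Prop :=
  (forall theta theta' : d.-tuple R,
    (forall i, eq_mod2pi (tnth theta i) (tnth theta' i)) ->
    Af theta = Af theta') /\
  exists W, [/\ gauge W, unitary (gauged_gelfand W) &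
    forall f g, gauged_gelfand W f g ->
      gauged_gelfand W (L f) (fun theta => Af theta (g theta))].

End Gelfand.

Definition magnetic_laplacian (P : periodic_graph R d) (alpha : lg_edge P -> R)
    (f : lg_vert P -> C) : lg_vert P -> C :=
  fun v => \sum_(e \in [set e | gsrc P e = v])
    (f v - cis (alpha e) * f (gtgt P e)).

End FiberOperators.

Section FromFiniteGraph.
Variables (R : realType) (d : nat) (V A : finType) (G : graph V A).
Variables (P : periodic_graph R d) (i : graph_iso G (fundamental_graph P)).

Definition lift_form (phi : A -> R) (e : lg_edge P) : R :=
  phi (iso_einv i (eclass e)).

Definition cell_of (v : V) : lg_vert P := cell_vertex (iso_v i v).

End FromFiniteGraph.

Definition degree (V A : finType) (G : graph V A) (v : V) : nat :=
  #|[set e | gsrc G e == v]%SET|.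

Definition model_family (R : realType) (d : nat) (V A : finType)
    (G : graph V A) (m : A -> 'rV[R]_d) (phi : A -> R)
    (theta : d.-tuple R) (f : V -> R[i]) : V -> R[i] :=
  fun v => (degree G v)%:R * f v -
    \sum_(e | gsrc G e == v)
      cis (phi e + inner_prod (m e) theta) * f (gtgt G e).

(* Main.v *)
Require Import Defs.
From HB Require Import structures.
From mathcomp Require Import all_boot all_order all_algebra.
From mathcomp Require Import finmap.
From mathcomp Require Import all_classical all_reals all_analysis.
From mathcomp Require Import measurable_realfun complex ring lra.
Set Implicit Arguments.
Unset Strict Implicit.
Unset Printing Implicit Defensive.
Import Order.TTheory GRing.Theory Num.Theory.
Import numFieldNormedType.Exports.
Local Open Scope classical_set_scope.
Local Open Scope ring_scope.

(** The periodic graph is the covering of [G] with vertices [V * Z ^ d], in which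
    an edge [e] of [G] from [v] to [u] lifts to the edges from [(v, n)] to
    [(u, n + m e)]. This makes sense because the values of [m] are integral
    vectors: a minimal form vanishes on a connected spanning subgraph
    ([minimal_form_zero_walk]), so that each [m e] is the flux of the cycle that
    closes [e] inside this subgraph ([minimal_form_integral]). The cover is
    connected because every vector of [Z ^ d] is the flux of a closed walk
    ([cycle_walk], [cover_connected]). It is drawn with [(v, n)] at [n] plus a
    point of the unit cube depending on [v]; hence the cell vertices are the
    [(v, 0)], and the Gelfand transform of [f] is the family of Fourier series
    with coefficients [f (v, n)].

    Without any gauge, [h] is thus the transform of [f] if and only if [h] is
    square integrable and [f (v, n)] is the [n]-th Fourier coefficient of
    [h _ v] ([gelfandP], [gauged_gelfandP]). The intertwining relation becomes
    the comparison of two formulas: multiplying by [e ^ (i <m e, theta>)] shifts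
    the index of a Fourier coefficient by [m e], and this is how the lifted
    edges act ([tcoef_model], [cover_magnetic_laplacian]). The integrality of
    [m] also gives the periodicity of the model in [theta].

    That the transform is unitary ([gelfand_unitary]) is the theory of Fourier
    series on the torus. Bessel's inequality follows from orthonormality by
    completing the square ([sqn_synthB]), the existence of a function with given
    coefficients is the Riesz-Fischer theorem ([riesz_fischer]), and Parseval's
    equality follows from these and from completeness ([parseval]).

    Completeness ([torus_char_complete]) says that an integrable [u] without
    Fourier coefficients vanishes almost everywhere. The space of such [u] is
    stable under multiplication by characters and under bounded limits, hence
    under multiplication by the indicators of the sets of a sigma-algebra.
    This sigma-algebra contains the half-spaces, whose indicators are limits of
    [(1 - p ^+ n) ^+ (2 ^ n)] for a trigonometric polynomial [p] with values in
    the unit interval that crosses 1/2 on their boundary ([power_threshold],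
    [multiplier_ray]), so it consists of all the measurable sets; therefore the
    integral of [u] over every measurable set is zero. *)

(** * Integration of complex-valued functions *)

Section ComplexParts.
Variable R : realType.
Implicit Types z w : R[i].
Local Notation Re := (@complex.Re R).
Local Notation Im := (@complex.Im R).

Lemma complex_eqP z w : Re z = Re w -> Im z = Im w -> z = w.
Proof. by case: z w => [a b] [c e] /= -> ->. Qed.

Lemma ReD z w : Re (z + w) = Re z + Re w. Proof. by case: z w => [a b] []. Qed.
Lemma ImD z w : Im (z + w) = Im z + Im w. Proof. by case: z w => [a b] []. Qed.
Lemma ReN z : Re (- z) = - Re z. Proof. by case: z. Qed.
Lemma ImN z : Im (- z) = - Im z. Proof. by case: z. Qed.
Lemma ReM z w : Re (z * w) = Re z * Re w - Im z * Im w.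
Proof. by case: z w => [a b] []. Qed.
Lemma ImM z w : Im (z * w) = Re z * Im w + Im z * Re w.
Proof. by case: z w => [a b] []. Qed.

Lemma Re_conjc z : Re (conjc z) = Re z. Proof. by case: z. Qed.
Lemma Im_conjc z : Im (conjc z) = - Im z. Proof. by case: z. Qed.

Lemma conjcM z w : conjc (z * w) = conjc z * conjc w.
Proof. by case: z w => [a b] [c e]; apply: complex_eqP; rewrite /=; ring. Qed.

Definition ReImE := (ReD, ImD, ReN, ImN, ReM, ImM).

Lemma sqmod_ge0 z : 0 <= sqmod z.
Proof. by rewrite addr_ge0 ?sqr_ge0. Qed.

Lemma sqmod0 : sqmod (0 : R[i]) = 0.
Proof. by rewrite /sqmod/= expr0n addr0. Qed.

Lemma sqmod1 : sqmod (1 : R[i]) = 1.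
Proof. by rewrite /sqmod/= expr0n addr0 expr1n. Qed.

Lemma sqmod_le0 z : sqmod z <= 0 -> z = 0.
Proof.
rewrite /sqmod; case: z => a b /= ab0.
have /eqP : a ^+ 2 + b ^+ 2 = 0 by apply/le_anti; rewrite ab0 addr_ge0 ?sqr_ge0.
by rewrite paddr_eq0 ?sqr_ge0// !sqrf_eq0 => /andP[/eqP-> /eqP->].
Qed.

Lemma sqmodM z w : sqmod (z * w) = sqmod z * sqmod w.
Proof. by rewrite /sqmod !ReImE; ring. Qed.

Lemma sqmodD_le z w : sqmod (z + w) <= 2 * (sqmod z + sqmod w).
Proof.
rewrite /sqmod !ReImE -subr_ge0.
have -> : 2 * (Re z ^+ 2 + Im z ^+ 2 + (Re w ^+ 2 + Im w ^+ 2)) -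
  ((Re z + Re w) ^+ 2 + (Im z + Im w) ^+ 2) =
  (Re z - Re w) ^+ 2 + (Im z - Im w) ^+ 2 by ring.
by rewrite addr_ge0 ?sqr_ge0.
Qed.

Lemma sqmod_cis (t : R) : sqmod (cis t) = 1.
Proof. by rewrite /sqmod/= cos2Dsin2. Qed.

Lemma cisD (s t : R) : cis (s + t) = cis s * cis t.
Proof. by apply: complex_eqP; rewrite /= ?cosD ?sinD//; ring. Qed.

Lemma cis0 : cis 0 = 1 :> R[i].
Proof. by rewrite /cis cos0 sin0. Qed.

Lemma cisN (t : R) : cis (- t) = conjc (cis t).
Proof. by rewrite /cis/= cosN sinN. Qed.

End ComplexParts.

Section ComplexIntegral.
Context d (T : measurableType d) (R : realType) (mu : probability T R).
Implicit Types u v : T -> R[i].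
Local Notation Re := (@complex.Re R).
Local Notation Im := (@complex.Im R).

(** The complex numbers carry no measurable structure, so measurability,
    integrability and the integral are taken separately on the real and the
    imaginary parts. *)
Definition cmeasurable u :=
  measurable_fun setT (fun x => Re (u x)) /\
  measurable_fun setT (fun x => Im (u x)).

Definition cintegrable u :=
  mu.-integrable setT (fun x => (Re (u x))%:E) /\
  mu.-integrable setT (fun x => (Im (u x))%:E).

Definition cint u : R[i] :=
  Complex (\int[mu]_x Re (u x)) (\int[mu]_x Im (u x)).

Lemma cintegrable_meas u : cintegrable u -> cmeasurable u.
Proof.
move=> [/measurable_int/measurable_EFinP u1].
by move=> /measurable_int/measurable_EFinP u2.
Qed.

Lemma cmeasurable_cst c : cmeasurable (fun=> c).
Proof. by split; exact: measurable_cst. Qed.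

Lemma cmeasurableD u v :
  cmeasurable u -> cmeasurable v -> cmeasurable (fun x => u x + v x).
Proof.
move=> [u1 u2] [v1 v2]; split.
  by under eq_fun do rewrite ReD; exact: measurable_funD.
by under eq_fun do rewrite ImD; exact: measurable_funD.
Qed.

Lemma cmeasurableM u v :
  cmeasurable u -> cmeasurable v -> cmeasurable (fun x => u x * v x).
Proof.
move=> [u1 u2] [v1 v2]; split.
  by under eq_fun do rewrite ReM; apply: measurable_funB; exact: measurable_funM.
by under eq_fun do rewrite ImM; apply: measurable_funD; exact: measurable_funM.
Qed.

Lemma cmeasurableZ c u : cmeasurable u -> cmeasurable (fun x => c * u x).
Proof. by apply: cmeasurableM; exact: cmeasurable_cst. Qed.

Lemma cmeasurableN u : cmeasurable u -> cmeasurable (fun x => - u x).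
Proof.
by under eq_fun do rewrite -mulN1r; exact: cmeasurableZ.
Qed.

Lemma cmeasurableB u v :
  cmeasurable u -> cmeasurable v -> cmeasurable (fun x => u x - v x).
Proof. by move=> hu hv; apply: cmeasurableD => //; exact: cmeasurableN. Qed.

Lemma cmeasurable_conj u : cmeasurable u -> cmeasurable (fun x => conjc (u x)).
Proof.
move=> [u1 u2]; split.
  by under eq_fun do rewrite Re_conjc.
by under eq_fun do rewrite Im_conjc; exact: measurableT_comp.
Qed.

Lemma cmeasurable_sqmod u :
  cmeasurable u -> measurable_fun setT (fun x => sqmod (u x)).
Proof. by move=> [u1 u2]; apply: measurable_funD; exact: measurable_funX. Qed.

Lemma bounded_integrable (f : T -> R) (M : R) : measurable_fun setT f ->
  (forall x, `|f x| <= M) -> mu.-integrable setT (EFin \o f).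
Proof.
move=> mf fM; apply: measurable_bounded_integrable => //.
  by rewrite (le_lt_trans (probability_le1 mu _))// ltry.
exists M; split; first exact: num_real.
by move=> y My x _; apply: (le_trans (fM x)); exact: ltW.
Qed.

Lemma integrable_dominated (f w : T -> R) : measurable_fun setT f ->
  mu.-integrable setT (EFin \o w) -> (forall x, `|f x| <= w x) ->
  mu.-integrable setT (EFin \o f).
Proof.
move=> mf iw fw; apply: le_integrable iw => //; first exact/measurable_EFinP.
by move=> x _ /=; rewrite lee_fin (le_trans (fw x))// ler_norm.
Qed.

Lemma cintegrableD u v :
  cintegrable u -> cintegrable v -> cintegrable (fun x => u x + v x).
Proof.
move=> [u1 u2] [v1 v2]; split.
  by under eq_fun do rewrite ReD EFinD; exact: integrableD.
by under eq_fun do rewrite ImD EFinD; exact: integrableD.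
Qed.

Lemma cintegrableZ c u : cintegrable u -> cintegrable (fun x => c * u x).
Proof.
move=> [u1 u2]; split.
  under eq_fun do rewrite ReM EFinB !EFinM.
  by apply: integrableB => //; exact: integrableZl.
under eq_fun do rewrite ImM EFinD !EFinM.
by apply: integrableD => //; exact: integrableZl.
Qed.

Lemma cintegrable_sum I (s : seq I) (f : I -> T -> R[i]) :
  (forall i, cintegrable (f i)) -> cintegrable (fun x => \sum_(i <- s) f i x).
Proof.
move=> mf; elim: s => [|i s IH].
  under eq_fun do rewrite big_nil.
  by split; exact: integrable0.
by under eq_fun do rewrite big_cons; exact: cintegrableD.
Qed.

Lemma cintD u v : cintegrable u -> cintegrable v ->
  cint (fun x => u x + v x) = cint u + cint v.
Proof.
move=> [u1 u2] [v1 v2]; apply: complex_eqP; rewrite ?ReD ?ImD /=.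
  by under eq_Rintegral do rewrite ReD; rewrite RintegralD.
by under eq_Rintegral do rewrite ImD; rewrite RintegralD.
Qed.

Lemma integrable_EFinZ (k : R) (f : T -> R) :
  mu.-integrable setT (EFin \o f) ->
  mu.-integrable setT (EFin \o (fun x => k * f x)).
Proof. by move=> fi; apply: (integrableZl measurableT k fi). Qed.

Lemma cintZ c u : cintegrable u -> cint (fun x => c * u x) = c * cint u.
Proof.
move=> [u1 u2]; apply: complex_eqP; rewrite ?ReM ?ImM /=.
  under eq_Rintegral do rewrite ReM.
  by rewrite RintegralB//= ?RintegralZl//; exact: integrable_EFinZ.
under eq_Rintegral do rewrite ImM.
by rewrite RintegralD//= ?RintegralZl//; exact: integrable_EFinZ.
Qed.

Lemma cint_cst c : cint (fun=> c) = c.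
Proof.
by apply: complex_eqP; rewrite /= Rintegral_cst//= probability_setT mulr1.
Qed.

Lemma cint0 : cint (fun=> 0) = 0.
Proof. exact: cint_cst. Qed.

Lemma cint_sum I (s : seq I) (f : I -> T -> R[i]) :
  (forall i, cintegrable (f i)) ->
  cint (fun x => \sum_(i <- s) f i x) = \sum_(i <- s) cint (f i).
Proof.
move=> mf; elim: s => [|i s IH].
  by rewrite big_nil; under [X in cint X]eq_fun do rewrite big_nil; exact: cint0.
rewrite big_cons -IH -cintD//; last exact: cintegrable_sum.
by congr cint; apply/funext => x; by rewrite big_cons.
Qed.

Lemma cintegrable_bounded u : cmeasurable u -> (forall x, sqmod (u x) <= 1) ->
  cintegrable u.
Proof.
move=> [u1 u2] ub; split; apply: (@bounded_integrable _ 1) => // x;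
  rewrite -(ler_pXn2r (n := 2)) ?nnegrE// expr1n real_normK ?num_real//;
  apply: le_trans (ub x); rewrite /sqmod ?lerDl ?lerDr; exact: sqr_ge0.
Qed.

Lemma cintegrableM_bounded b u : cmeasurable b ->
  (forall x, sqmod (b x) <= 1) -> cintegrable u ->
  cintegrable (fun x => b x * u x).
Proof.
move=> mb bb iu.
have [m1 m2] := cmeasurableM mb (cintegrable_meas iu).
have [u1 u2] := iu.
have iN : mu.-integrable setT (EFin \o fun x => `|Re (u x)| + `|Im (u x)|).
  rewrite (_ : EFin \o _ = (fun x => (`|Re (u x)|)%:E + (`|Im (u x)|)%:E)%E)//.
  apply: integrableD => //; exact: integrable_norm.
have le1 (a c : R) : a ^+ 2 + c ^+ 2 <= 1 -> `|a| <= 1.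
  move=> ac; rewrite -(ler_pXn2r (n := 2)) ?nnegrE// expr1n real_normK ?num_real//.
  by apply: le_trans ac; rewrite lerDl sqr_ge0.
have bR x : `|Re (b x)| <= 1 by apply: le1 (bb x).
have bI x : `|Im (b x)| <= 1 by apply: (le1 _ (Re (b x))); rewrite addrC; exact: bb.
split; apply: (integrable_dominated _ iN) => // x; rewrite !ReImE.
  rewrite (le_trans (ler_normB _ _))// !normrM lerD//; exact: ler_piMl.
rewrite (le_trans (ler_normD _ _))// !normrM addrC lerD//; exact: ler_piMl.
Qed.

End ComplexIntegral.

(** * Square-integrable functions and orthonormal systems *)

Section SquareIntegrable.
Context d (T : measurableType d) (R : realType) (mu : probability T R).
Implicit Types u v : T -> R[i].
Local Notation Re := (@complex.Re R).
Local Notation Im := (@complex.Im R).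

Definition L2 u :=
  cmeasurable u /\ (\int[mu]_x (sqmod (u x))%:E < +oo)%E.

Definition sqn u : R := \int[mu]_x sqmod (u x).

Lemma L2_sqmod_integrable u :
  L2 u -> mu.-integrable setT (EFin \o (fun x => sqmod (u x))).
Proof.
move=> [um uoo]; apply/integrableP; split.
  by apply/measurable_EFinP; exact: cmeasurable_sqmod.
by under eq_integral do rewrite gee0_abs ?lee_fin ?sqmod_ge0//.
Qed.

Lemma integrable_L2 u : cmeasurable u ->
  mu.-integrable setT (EFin \o (fun x => sqmod (u x))) -> L2 u.
Proof.
move=> um /integrableP[_]; under eq_integral do
  rewrite gee0_abs ?lee_fin ?sqmod_ge0//.
by [].
Qed.

Lemma integral_sqmod u :
  L2 u -> (\int[mu]_x (sqmod (u x))%:E)%E = (sqn u)%:E.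
Proof.
move=> /L2_sqmod_integrable ui; rewrite /sqn /Rintegral fineK//.
exact: integrable_fin_num.
Qed.

Lemma sqn_ge0 u : 0 <= sqn u.
Proof. by apply: Rintegral_ge0 => x _; exact: sqmod_ge0. Qed.

Lemma L2M_cintegrable u v : L2 u -> L2 v -> cintegrable mu (fun x => u x * v x).
Proof.
move=> u2 v2; have [um _] := u2; have [vm _] := v2.
have wi : mu.-integrable setT (EFin \o (fun x => sqmod (u x) + sqmod (v x))).
  rewrite (_ : EFin \o _ =
    (fun x => (sqmod (u x))%:E + (sqmod (v x))%:E)%E)//.
  by apply: integrableD => //; exact: L2_sqmod_integrable.
have [m1 m2] := cmeasurableM um vm.
have sq2 (a b c e : R) : `|a * b + c * e| <= a ^+ 2 + c ^+ 2 + (b ^+ 2 + e ^+ 2).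
  have := sqr_ge0 (a - b); have := sqr_ge0 (c - e).
  have := sqr_ge0 (a + b); have := sqr_ge0 (c + e).
  by rewrite ler_norml; move=> *; apply/andP; split; nra.
split; apply: (integrable_dominated _ wi) => // x; rewrite !ReImE /sqmod.
  by rewrite -mulNr; apply: le_trans (sq2 _ _ _ _) _; rewrite sqrrN.
by apply: le_trans (sq2 _ _ _ _) _; rewrite [Im (v x) ^+ 2 + _]addrC.
Qed.

Lemma L2_bounded u : cmeasurable u -> (forall x, sqmod (u x) <= 1) -> L2 u.
Proof.
move=> um u1; apply: integrable_L2 => //.
apply: (@bounded_integrable _ _ _ mu _ 1) => [|x]; first exact: cmeasurable_sqmod.
by rewrite ger0_norm ?sqmod_ge0.
Qed.

Lemma L2_cintegrable u : L2 u -> cintegrable mu u.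
Proof.
move=> u2; have := @L2M_cintegrable u (fun=> 1) u2.
under [fun x => u x * 1]eq_fun do rewrite mulr1.
apply; apply: L2_bounded => [|x]; first exact: cmeasurable_cst.
by rewrite sqmod1.
Qed.

Lemma L2D u v : L2 u -> L2 v -> L2 (fun x => u x + v x).
Proof.
move=> u2 v2; have [um _] := u2; have [vm _] := v2.
apply: integrable_L2; first exact: cmeasurableD.
have wi : mu.-integrable setT
    (EFin \o (fun x => 2 * (sqmod (u x) + sqmod (v x)))).
  apply: integrable_EFinZ.
  rewrite (_ : EFin \o _ =
    (fun x => (sqmod (u x))%:E + (sqmod (v x))%:E)%E)//.
  by apply: integrableD => //; exact: L2_sqmod_integrable.
apply: (integrable_dominated _ wi) => [|x].
  by apply: cmeasurable_sqmod; exact: cmeasurableD.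
by rewrite ger0_norm ?sqmod_ge0// sqmodD_le.
Qed.

Lemma L2M_bounded b u : cmeasurable b -> (forall x, sqmod (b x) <= 1) ->
  L2 u -> L2 (fun x => b x * u x).
Proof.
move=> bm b1 u2; have [um _] := u2.
apply: integrable_L2; first exact: cmeasurableM.
apply: (integrable_dominated _ (L2_sqmod_integrable u2)) => [|x].
  by apply: cmeasurable_sqmod; exact: cmeasurableM.
rewrite ger0_norm ?sqmod_ge0// sqmodM; apply: ler_piMl => //.
exact: sqmod_ge0.
Qed.

Lemma L2Z c u : L2 u -> L2 (fun x => c * u x).
Proof.
move=> u2; have [um _] := u2.
apply: integrable_L2; first exact: cmeasurableZ.
under eq_fun do rewrite sqmodM.
exact/integrable_EFinZ/L2_sqmod_integrable.
Qed.

Lemma L2N u : L2 u -> L2 (fun x => - u x).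
Proof. by under eq_fun do rewrite -mulN1r; exact: L2Z. Qed.

Lemma L2B u v : L2 u -> L2 v -> L2 (fun x => u x - v x).
Proof. by move=> u2 v2; apply: L2D => //; exact: L2N. Qed.

Lemma L2_0 : L2 (fun=> 0).
Proof.
apply: L2_bounded => [|x]; first exact: cmeasurable_cst.
by rewrite sqmod0.
Qed.

Lemma L2_sum I (s : seq I) (P : pred I) (f : I -> T -> R[i]) :
  (forall i, L2 (f i)) -> L2 (fun x => \sum_(i <- s | P i) f i x).
Proof.
move=> f2; elim: s => [|i s IH].
  by under eq_fun do rewrite big_nil; exact: L2_0.
under eq_fun do rewrite big_cons; case: (P i) => //.
exact: L2D.
Qed.

End SquareIntegrable.

Section OrthonormalSystem.
Context d (T : measurableType d) (R : realType) (mu : probability T R).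
Variables (I : choiceType) (e : I -> T -> R[i]).
Hypothesis em : forall i, cmeasurable (e i).
Hypothesis e1 : forall i x, sqmod (e i x) = 1.
Hypothesis e_orth : forall i j,
  cint mu (fun x => e i x * conjc (e j x)) = (i == j)%:R.
Implicit Types (h : T -> R[i]) (a : I -> R[i]) (s : seq I).
Local Notation Re := (@complex.Re R).
Local Notation L2 := (L2 mu).
Local Notation sqn := (sqn mu).

(** The system plays the role of the exponentials [e^(i <n, theta>)], and the
    expansions use their conjugates, as the Gelfand transform does. *)
Definition coef h i : R[i] := cint mu (fun x => e i x * h x).

Definition synth s a : T -> R[i] := fun x => \sum_(i <- s) conjc (e i x) * a i.

Lemma sqmod_conj (z : R[i]) : sqmod (conjc z) = sqmod z.
Proof. by rewrite /sqmod Re_conjc Im_conjc sqrrN. Qed.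

Let coef_cintegrable h i : L2 h -> cintegrable mu (fun x => e i x * h x).
Proof.
by move=> h2; apply: L2_cintegrable; apply: L2M_bounded => // x; rewrite e1.
Qed.

Let conj_e2 i : L2 (fun x => conjc (e i x)).
Proof.
apply: L2_bounded => [|x]; first exact: cmeasurable_conj.
by rewrite sqmod_conj e1.
Qed.

Lemma synth_L2 s a : L2 (synth s a).
Proof.
apply: L2_sum => i; under eq_fun do rewrite mulrC; exact: L2Z.
Qed.

Lemma coefD h k i : L2 h -> L2 k ->
  coef (fun x => h x + k x) i = coef h i + coef k i.
Proof.
move=> h2 k2; rewrite /coef -cintD; [|exact: coef_cintegrable..].
by congr cint; apply/funext => x; rewrite mulrDr.
Qed.

Lemma coefZ c h i : L2 h -> coef (fun x => c * h x) i = c * coef h i.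
Proof.
move=> h2; rewrite /coef -cintZ; last exact: coef_cintegrable.
by congr cint; apply/funext => x; rewrite mulrCA.
Qed.

Lemma coefB h k i : L2 h -> L2 k ->
  coef (fun x => h x - k x) i = coef h i - coef k i.
Proof.
move=> h2 k2; rewrite coefD//; last exact: L2N.
congr (_ + _); under [X in coef X]eq_fun do rewrite -mulN1r.
by rewrite coefZ// mulN1r.
Qed.

Lemma coef_suml (J : Type) (r : seq J) (P : pred J) (f : J -> T -> R[i]) i :
  (forall j, L2 (f j)) ->
  coef (fun x => \sum_(j <- r | P j) f j x) i = \sum_(j <- r | P j) coef (f j) i.
Proof.
move=> f2; elim: r => [|j r IH].
  under [X in coef X]eq_fun do rewrite big_nil.
  rewrite big_nil /coef -[RHS](cint0 mu); congr cint; apply/funext => x.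
  by rewrite mulr0.
under [X in coef X]eq_fun do rewrite big_cons.
rewrite big_cons; case: (P j) => //.
by rewrite coefD// ?IH//; exact: L2_sum.
Qed.

Lemma coef_synth s a i : uniq s -> coef (synth s a) i = if i \in s then a i else 0.
Proof.
move=> us; rewrite /synth coef_suml; last first.
  by move=> j; under eq_fun do rewrite mulrC; exact: L2Z.
rewrite (eq_bigr (fun j => (i == j)%:R * a j)); last first.
  move=> j _; under [X in coef X]eq_fun do rewrite mulrC.
  by rewrite coefZ// mulrC /coef e_orth.
case: ifPn => si.
  rewrite (bigD1_seq i)//= eqxx mul1r big1 ?addr0// => j ji.
  by rewrite eq_sym (negbTE ji) mul0r.
rewrite big_seq big1// => j js; case: eqP => [ij|]; last by rewrite mul0r.
by rewrite ij js in si.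
Qed.

(** Completing the square in the coefficients: the squared distance from [h]
    to a finite combination is the Bessel defect of [h] plus the squared errors
    of the coefficients. Bessel's inequality, the isometry property and both
    directions of the convergence criterion are read off this identity. *)
Lemma sqn_synthB s a h : uniq s -> L2 h ->
  sqn (fun x => synth s a x - h x) =
  sqn h - \sum_(i <- s) sqmod (coef h i) + \sum_(i <- s) sqmod (a i - coef h i).
Proof.
move=> us h2; pose k x := synth s a x - 2 * h x.
have k2 : L2 k by apply: L2B; [exact: synth_L2|exact: L2Z].
have -> : sqn (fun x => synth s a x - h x) =
    sqn h + Re (\sum_(i <- s) conjc (a i) * coef k i).
  rewrite (_ : \sum_(i <- s) _ =
      cint mu (fun x => \sum_(i <- s) conjc (a i) * (e i x * k x))); last first.
    rewrite cint_sum; last by move=> i; apply: cintegrableZ; exact: coef_cintegrable.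
    by apply: eq_bigr => i _; rewrite cintZ//; exact: coef_cintegrable.
  rewrite /= /sqn -RintegralD//.
  - apply: eq_Rintegral => x _.
    have -> : \sum_(i <- s) conjc (a i) * (e i x * k x) =
        conjc (synth s a x) * k x.
      rewrite /synth raddf_sum mulr_suml; apply: eq_bigr => i _.
      by rewrite /= conjcM conjcK mulrA; congr (_ * _); rewrite mulrC.
    rewrite /k; case: (synth s a x) (h x) => [p q] [z w].
    by rewrite !ReImE /sqmod/=; ring.
  - exact: L2_sqmod_integrable.
  - apply: (@proj1 _ (mu.-integrable setT (fun x => (complex.Im _)%:E))).
    apply: (@cintegrable_sum _ _ _ mu _ s (fun i x => conjc (a i) * (e i x * k x))).
    by move=> i; apply: cintegrableZ; exact: coef_cintegrable.
rewrite -addrA; congr (_ + _); rewrite -sumrN -big_split/=.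
rewrite (big_morph Re (@ReD R) (erefl : Re 0 = 0)).
rewrite big_seq [RHS]big_seq; apply: eq_bigr => i si.
rewrite /k coefB; [|exact: synth_L2|exact: L2Z].
rewrite coef_synth// si coefZ//.
case: (a i) (coef h i) => [p q] [z w]; rewrite /sqmod !ReImE /=; ring.
Qed.

Lemma bessel s h : uniq s -> L2 h -> \sum_(i <- s) sqmod (coef h i) <= sqn h.
Proof.
move=> us h2; rewrite -subr_ge0.
have := sqn_synthB (coef h) us h2.
rewrite [X in _ + X]big1 ?addr0; last by move=> i _; rewrite subrr sqmod0.
by move=> <-; exact: sqn_ge0.
Qed.

(** Convergence of the sums in the mean determines the coefficients. *)
Lemma coef_error s a h i : uniq s -> L2 h -> i \in s ->
  sqmod (a i - coef h i) <= sqn (fun x => synth s a x - h x).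
Proof.
move=> us h2 si; rewrite sqn_synthB// [X in _ <= _ + X](bigD1_seq i si)//= addrCA lerDl.
rewrite addr_ge0 ?subr_ge0 ?bessel// sumr_ge0// => j _; exact: sqmod_ge0.
Qed.

Lemma sqn_synth s a : uniq s -> sqn (synth s a) = \sum_(i <- s) sqmod (a i).
Proof.
move=> us; have := sqn_synthB a us (L2_0 mu).
have c0 i : coef (fun=> 0) i = 0.
  by rewrite /coef -[RHS](cint0 mu); congr cint; apply/funext => x; rewrite mulr0.
rewrite [X in _ - X]big1 => [|i _]; last by rewrite c0 sqmod0.
under [X in _ = _ + X]eq_bigr do rewrite c0 subr0.
rewrite /sqn; under eq_Rintegral do rewrite subr0.
move=> ->; rewrite subr0 (_ : \int[mu]_x _ = 0) ?add0r//.
by under eq_Rintegral do rewrite sqmod0; rewrite Rintegral_cst// mul0r.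
Qed.

End OrthonormalSystem.

(** * Completeness of the space of square-integrable functions *)

Section RieszFischer.
Context d (T : measurableType d) (R : realType) (mu : probability T R).
Variable u : nat -> T -> R.
Hypothesis um : forall n, measurable_fun setT (u n).
Hypothesis u_cauchy : forall k j, (k <= j)%N ->
  (\int[mu]_x ((u j x - u k x) ^+ 2)%:E <= (4 ^- k)%:E)%E.

Let step k x : R := `|u k.+1 x - u k x|.

Let step_ge0 k x : 0 <= step k x.
Proof. exact: normr_ge0. Qed.

Let step_meas k : measurable_fun setT (step k).
Proof. by apply: measurableT_comp => //; exact: measurable_funB. Qed.

Let step_integral k : (\int[mu]_x (step k x)%:E <= (2 * 2 ^- k)%:E)%E.
Proof.
have mb : measurable_fun setT (fun x => (u k.+1 x - u k x) ^+ 2).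
  by apply/measurable_funX/measurable_funB.
have k0 : 0 < 2 ^+ k :> R by rewrite exprn_gt0.
apply: (@le_trans _ _ (\int[mu]_x
    ((2 ^+ k)%:E * ((u k.+1 x - u k x) ^+ 2)%:E + (2 ^- k)%:E))%E).
  apply: ge0_le_integral => //.
  - by move=> x _; rewrite lee_fin /step.
  - exact/measurable_EFinP.
  - apply: emeasurable_funD => //; apply: emeasurable_funM => //.
    exact/measurable_EFinP.
  - move=> x _; rewrite -EFinM -EFinD lee_fin /step.
    set t := u _ _ - _.
    (* t ^+ 2 is scaled so that both terms have integral of order 2 ^- k *)
    have := sqr_ge0 (2 ^+ k * `|t| - 1).
    have -> : (2 ^+ k * `|t| - 1) ^+ 2 =
        2 ^+ k * (2 ^+ k * t ^+ 2 + 2 ^- k - 2 * `|t|).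
      by rewrite -(real_normK (num_real t)); field; rewrite gt_eqF.
    rewrite pmulr_rge0// subr_ge0; apply: le_trans.
    by rewrite mulr_natl mulr2n lerDl.
rewrite ge0_integralD//=; first last.
- by apply: emeasurable_funM => //; exact/measurable_EFinP.
- by move=> x _; rewrite -EFinM lee_fin mulr_ge0 ?sqr_ge0// ltW.
rewrite ge0_integralZl_EFin//; first last.
- exact/measurable_EFinP.
- by move=> x _; rewrite lee_fin sqr_ge0.
rewrite integral_cst//= probability_setT mule1.
apply: (@le_trans _ _ ((2 ^+ k)%:E * (4 ^- k)%:E + (2 ^- k)%:E)%E).
  by rewrite leeD2r// lee_pmul2l ?lte_fin//; exact: u_cauchy.
rewrite -EFinM -EFinD lee_fin.
have -> : 4 ^+ k = 2 ^+ k * 2 ^+ k :> R by rewrite -exprMn; congr (_ ^+ _); ring.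
have -> : 2 ^+ k / (2 ^+ k * 2 ^+ k) = 2 ^- k :> R by field; rewrite gt_eqF.
lra.
Qed.

Let total x : \bar R := (\sum_(k <oo) (step k x)%:E)%E.

Let total_finite : {ae mu, forall x, (total x < +oo)%E}.
Proof.
have tm : measurable_fun setT total.
  apply: ge0_emeasurable_sum => [k x _ _|k _]; first by rewrite lee_fin step_ge0.
  exact/measurable_EFinP.
have ti : mu.-integrable setT total.
  apply/integrableP; split => //.
  have t0 x : (0 <= total x)%E.
    by apply: nneseries_ge0 => k _ _; rewrite lee_fin step_ge0.
  under eq_integral do rewrite gee0_abs//.
  rewrite integral_nneseries//; last first.
  - by move=> k x _; rewrite lee_fin step_ge0.
  - by move=> k; exact/measurable_EFinP.
  apply: (@le_lt_trans _ _ 4%:E); last by rewrite ltry.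
  apply: lime_le.
    apply: is_cvg_nneseries => k _ _; apply: integral_ge0 => x _.
    by rewrite lee_fin step_ge0.
  apply: nearW => n.
  apply: (@le_trans _ _ (4 - 4 * 2 ^- n)%:E); last first.
    by rewrite lee_fin gerBl mulr_ge0// invr_ge0 exprn_ge0.
  elim: n => [|n IH].
    by rewrite big_nil lee_fin expr0 invr1 mulr1 subrr.
  rewrite big_nat_recr//=; apply: le_trans (leeD IH (step_integral n)) _.
  rewrite -EFinD lee_fin exprS.
  have n0 : 0 < 2 ^+ n :> R by rewrite exprn_gt0.
  rewrite le_eqVlt; apply/orP; left; apply/eqP.
  by field; rewrite gt_eqF.
apply: filterS (integrable_ae measurableT ti) => x /(_ I).
by rewrite fin_numE ltey => /andP[_].
Qed.

Let converges x : (total x < +oo)%E -> cvgn (u ^~ x).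
Proof.
move=> toty.
have : cvgn (series (telescope (u ^~ x))).
  apply: normed_cvg; apply: nondecreasing_is_cvgn.
    by apply: nondecreasing_series => k _ _; exact: normr_ge0.
  exists (fine (total x)) => _ [n _ <-].
  rewrite -lee_fin fineK; last first.
    rewrite ge0_fin_numE//.
    by apply: nneseries_ge0 => k _ _; rewrite lee_fin step_ge0.
  rewrite /series/= -sumEFin.
  by apply: nneseries_lim_ge => k _ _; rewrite lee_fin step_ge0.
rewrite telescopeK => c.
have -> : u ^~ x = (fun n => (u n x - u 0%N x) + u 0%N x).
  by apply/funext => n; rewrite subrK.
by apply: is_cvgD => //; exact: is_cvg_cst.
Qed.

(** A sequence that is Cauchy in the mean at a geometric rate converges almost
    everywhere, because the sum of the increments is integrable; by Fatou's
    lemma the pointwise limit is also the limit in the mean. *)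
Lemma L2_limit : exists w : T -> R, measurable_fun setT w /\
  forall k, (\int[mu]_x ((w x - u k x) ^+ 2)%:E <= (4 ^- k)%:E)%E.
Proof.
(* the upper limit is measurable whether or not the sequence converges *)
pose w x : R := fine (limn_esup (fun n => (u n x)%:E)).
have wm : measurable_fun setT w.
  apply: measurableT_comp => //.
  by apply: measurable_fun_limn_esup => n; exact/measurable_EFinP.
exists w; split => // k.
pose D n x : \bar R := ((u (n + k)%N x - u k x) ^+ 2)%:E.
have Dm n : measurable_fun setT (D n).
  by apply/measurable_EFinP/measurable_funX/measurable_funB.
have D0 n x : setT x -> (0 <= D n x)%E by move=> _; rewrite lee_fin sqr_ge0.
apply: (@le_trans _ _ (\int[mu]_x limn_einf (D ^~ x))%E).
  apply: ae_ge0_le_integral => //.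
  - by move=> x _; rewrite lee_fin sqr_ge0.
  - by apply/measurable_EFinP/measurable_funX/measurable_funB.
  - move=> x _; rewrite limn_einf_lim; apply: lime_ge.
      exact: is_cvg_einfs.
    by apply: nearW => n; apply: le_ereal_inf_tmp => _ [j _ <-]; exact: D0.
  - apply: measurableT_comp => //; apply: measurable_fun_limn_esup => n.
    exact: measurableT_comp.
  apply: filterS total_finite => x /converges ux _.
  have wl : w x = limn (u ^~ x).
    have /cvg_limn_einf_sup[_ h] :
        (fun n => (u n x)%:E) @ \oo --> (limn (u ^~ x))%:E.
      by apply: cvg_EFin => //; exact: nearW.
    by rewrite /w h.
  have /cvg_limn_einf_sup[-> _]// : D ^~ x @ \oo --> ((w x - u k x) ^+ 2)%:E.
  apply: cvg_EFin; first exact: nearW.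
  have uk : (fun n => u (n + k)%N x - u k x) @ \oo --> w x - u k x.
    rewrite wl; apply: cvgB; last exact: cvg_cst.
    by rewrite (cvg_shiftn k (u ^~ x)).
  exact: (cvgM uk uk).
apply: le_trans (fatou _ _ _ _) _ => //.
apply: (@le_trans _ _ (limn_esup (fun n => \int[mu]_x D n x)%E)).
  exact: limn_einf_sup.
rewrite limn_esup_lim; apply: lime_le; first exact: is_cvg_esups.
apply: nearW => n; apply: ge_ereal_sup => _ [j _ <-].
by apply: u_cauchy; exact: leq_addl.
Qed.

End RieszFischer.

(** * Riesz-Fischer and Parseval theorems *)

Section UnorderedSums.
Variables (R : realType) (I : choiceType) (g : I -> R).

Lemma le_sum_esum (s : seq I) : uniq s ->
  ((\sum_(i <- s) g i)%:E <= \esum_(i in [set: I]) (g i)%:E)%E.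
Proof.
move=> us; apply: esum_ge; exists [set` s]; first by split => //; exact: finite_seq.
by rewrite -fsbig_seq//= sumEFin.
Qed.

Lemma esum_le (M : \bar R) :
  (forall s, uniq s -> ((\sum_(i <- s) g i)%:E <= M)%E) ->
  (\esum_(i in [set: I]) (g i)%:E <= M)%E.
Proof.
move=> gM; apply: ge_ereal_sup => _ [X [finX _] <-].
by rewrite fsbig_finite//= sumEFin; apply: gM; exact: fset_uniq.
Qed.

Lemma lt_esum_fset (y : R) : (y%:E < \esum_(i in [set: I]) (g i)%:E)%E ->
  exists F : {fset I}, y < \sum_(i <- F) g i.
Proof.
move=> /ereal_sup_gt[_ [X [finX _] <-]].
by rewrite fsbig_finite//= sumEFin lte_fin => yX; exists (fset_set X).
Qed.

End UnorderedSums.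

Section CompleteOrthonormalSystem.
Context d (T : measurableType d) (R : realType) (mu : probability T R).
Variables (I : countType) (e : I -> T -> R[i]).
Hypothesis em : forall i, cmeasurable (e i).
Hypothesis e1 : forall i x, sqmod (e i x) = 1.
Hypothesis e_orth : forall i j,
  cint mu (fun x => e i x * conjc (e j x)) = (i == j)%:R.
Implicit Types (h : T -> R[i]) (a : I -> R[i]) (s : seq I).
Local Notation Re := (@complex.Re R).
Local Notation Im := (@complex.Im R).
Local Notation L2 := (L2 mu).
Local Notation sqn := (sqn mu).
Local Notation coef := (coef mu e).
Local Notation synth := (synth e).

Definition sqsum a : \bar R := \esum_(i in [set: I]) (sqmod (a i))%:E.

Lemma bessel_esum h : L2 h -> (sqsum (coef h) <= (sqn h)%:E)%E.
Proof.
move=> h2; apply: esum_le => s us.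
by rewrite lee_fin bessel.
Qed.

Let first_indices (k : nat) : seq I := pmap (@pickle_inv I) (iota 0 k).

Let first_uniq k : uniq (first_indices k).
Proof. by apply: (pmap_uniq (@pickle_invK I)); exact: iota_uniq. Qed.

Let first_cat k j : exists2 r, uniq r &
  first_indices (k + j) = first_indices k ++ r.
Proof.
exists (pmap (@pickle_inv I) (iota k j)).
  by apply: (pmap_uniq (@pickle_invK I)); exact: iota_uniq.
by rewrite /first_indices iotaD pmap_cat.
Qed.

Let mem_first i k : (choice.pickle i < k)%N -> i \in first_indices k.
Proof.
move=> ik; rewrite mem_pmap; apply/mapP; exists (choice.pickle i).
  by rewrite mem_iota.
by rewrite pickleK_inv.
Qed.

(** The partial sums along an enumeration of the indices form a Cauchy sequence;
    a subsequence with geometric rate has a limit in the mean, whose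
    coefficients are the prescribed ones because every index is eventually
    included. Parseval's inequality passes to the limit. *)
Lemma riesz_fischer a : (sqsum a < +oo)%E ->
  exists h, [/\ L2 h, forall i, coef h i = a i & ((sqn h)%:E <= sqsum a)%E].
Proof.
move=> aoo; pose E := first_indices.
pose S k := \sum_(i <- E k) sqmod (a i).
have S_le k : ((S k)%:E <= sqsum a)%E.
  exact/le_sum_esum/first_uniq.
have afin : sqsum a \is a fin_num.
  by rewrite ge0_fin_numE// esum_ge0// => i _; rewrite lee_fin sqmod_ge0.
have S_nd : {homo S : k j / (k <= j)%N >-> k <= j}.
  move=> k j /subnKC <-; have [r _ Ekr] := first_cat k (j - k).
  rewrite /S /E Ekr big_cat/= lerDl sumr_ge0// => i _; exact: sqmod_ge0.
have S_cvg : cvgn S.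
  apply: nondecreasing_is_cvgn => //.
  by exists (fine (sqsum a)) => _ [k _ <-]; rewrite -lee_fin fineK.
have S_lim k : S k <= limn S by apply: nondecreasing_cvgn_le.
have /choice[N NP] : forall k, exists n, forall j, (n <= j)%N ->
    S j - S n <= 4 ^- k.
  move=> k; have k0 : 0 < 4 ^- k :> R by rewrite invr_gt0 exprn_gt0.
  have /cvgrPdist_lt /(_ _ k0) [n _ nP] := S_cvg.
  exists n => j nj; have := nP n (leqnn n).
  rewrite ger0_norm ?subr_ge0// => /ltW; apply: le_trans.
  by rewrite lerB.
(* an increasing sequence above N and above the identity: the first makes the
   rate geometric, the second lets every index enter the partial sums *)
pose M k := (\sum_(i < k.+1) (N i).+1)%N.
have M_nd k j : (k <= j)%N -> (M k <= M j)%N.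
  move=> /subnKC <-; elim: (j - k)%N => [|n IH]; first by rewrite addn0.
  by rewrite addnS {2}/M big_ord_recr/= (leq_trans IH)// leq_addr.
have MN k : (N k <= M k)%N by rewrite /M big_ord_recr/= addnS leqW// leq_addl.
have Mk k : (k < M k)%N.
  elim: k => [|k IH]; first by rewrite /M big_ord_recr/= addnS.
  by rewrite /M big_ord_recr/= addnS ltnS (leq_trans IH)// leq_addr.
pose f k := synth (E (M k)) a.
have f2 k : L2 (f k) by exact: synth_L2.
have f_cauchy k j : (k <= j)%N -> sqn (fun x => f j x - f k x) <= 4 ^- k.
  move=> kj; have [r ur Ekr] := first_cat (M k) (M j - M k).
  rewrite subnKC ?M_nd// in Ekr.
  have -> : (fun x => f j x - f k x) = synth r a.
    by apply/funext => x; rewrite /f /synth /E Ekr big_cat/= addrAC subrr add0r.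
  rewrite (sqn_synth em e1 e_orth)//.
  have -> : \sum_(i <- r) sqmod (a i) = S (M j) - S (M k).
    by rewrite /S /E Ekr big_cat/= addrAC subrr add0r.
  apply: le_trans (NP k (M j) (leq_trans (MN k) (M_nd _ _ kj))).
  by rewrite lerB// S_nd.
(* the limit is built separately for P := Re and P := Im *)
have part (P : R[i] -> R) (PB : forall z w, P (z - w) = P z - P w)
    (Psq : forall z, P z ^+ 2 <= sqmod z)
    (Pm : forall k, measurable_fun setT (fun x => P (f k x))) :
    exists w : T -> R, measurable_fun setT w /\
  forall k, (\int[mu]_x ((w x - P (f k x)) ^+ 2)%:E <= (4 ^- k)%:E)%E.
  apply: (L2_limit Pm) => k j kj.
  apply: (@le_trans _ _ (\int[mu]_x (sqmod (f j x - f k x))%:E)%E); last first.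
    by rewrite integral_sqmod ?lee_fin ?f_cauchy//; exact: L2B.
  have jk2 := L2B (f2 j) (f2 k).
  apply: ge0_le_integral => //.
  - by move=> x _; rewrite lee_fin sqr_ge0.
  - by apply/measurable_EFinP/measurable_funX/measurable_funB.
  - by apply/measurable_EFinP/cmeasurable_sqmod; case: jk2.
  - by move=> x _; rewrite lee_fin -PB.
have [| | |w1 [w1m w1P]] := part Re.
- by move=> z w; rewrite !ReImE.
- by move=> z; rewrite /sqmod lerDl sqr_ge0.
- by move=> k; have [[]] := f2 k.
have [| | |w2 [w2m w2P]] := part Im.
- by move=> z w; rewrite !ReImE.
- by move=> z; rewrite /sqmod lerDr sqr_ge0.
- by move=> k; have [[]] := f2 k.
pose h x := Complex (w1 x) (w2 x).
have hm : cmeasurable h by split.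
have fh k : (\int[mu]_x (sqmod (f k x - h x))%:E <= (2 * 4 ^- k)%:E)%E.
  have [[f1m f2m] _] := f2 k.
  rewrite (_ : (fun x => _) = (fun x => ((w1 x - Re (f k x)) ^+ 2)%:E +
      ((w2 x - Im (f k x)) ^+ 2)%:E)%E); last first.
    by apply/funext => x; rewrite -EFinD /sqmod !ReImE/=; congr EFin; ring.
  rewrite ge0_integralD//.
  - by rewrite mulr_natl mulr2n EFinD leeD.
  - by move=> x _; rewrite lee_fin sqr_ge0.
  - by apply/measurable_EFinP/measurable_funX/measurable_funB.
  - by move=> x _; rewrite lee_fin sqr_ge0.
  - by apply/measurable_EFinP/measurable_funX/measurable_funB.
have fh2 k : L2 (fun x => f k x - h x).
  split; last exact: le_lt_trans (fh k) (ltry _).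
  by apply: cmeasurableB => //; case: (f2 k).
have h2 : L2 h.
  have := L2B (f2 0%N) (fh2 0%N); congr L2.
  by apply/funext => x; rewrite opprB addrC subrK.
have {}fh k : sqn (fun x => f k x - h x) <= 2 * 4 ^- k.
  by rewrite -lee_fin -integral_sqmod.
have small (x : R) :
    (exists k0, forall k, (k0 <= k)%N -> x <= 2 * 4 ^- k) -> x <= 0.
  move=> [k0 kx]; rewrite leNgt; apply/negP => x0.
  have : (fun k => 2 * 4^-1 ^+ k) @ \oo --> (2 * 0 : R).
    by apply: cvgM; [exact: cvg_cst|apply: cvg_expr; rewrite ger0_norm//; lra].
  rewrite mulr0 => /cvgrPdist_lt /(_ _ x0)[n _ nP].
  have := nP (maxn k0 n) (leq_maxr _ _); have := kx (maxn k0 n) (leq_maxl _ _).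
  rewrite /= sub0r normrN ger0_norm ?mulr_ge0 ?exprn_ge0//.
  by rewrite exprVn => /le_lt_trans /[apply]; rewrite ltxx.
have ch i : coef h i = a i.
  have : sqmod (a i - coef h i) <= 0.
    apply: small; exists (choice.pickle i) => k ik; apply: le_trans (fh k).
    apply: (coef_error em e1 e_orth) => //.
    by apply: mem_first; exact: leq_ltn_trans (Mk k).
  by move=> /sqmod_le0 /subr0_eq.
exists h; split => //.
rewrite -(fineK afin) lee_fin -subr_le0; apply: small; exists 0%N => k _.
apply: le_trans (fh k).
rewrite /f (sqn_synthB em e1 e_orth)//.
rewrite [X in _ <= _ + X]big1 ?addr0; last by move=> i _; rewrite ch subrr sqmod0.
rewrite lerD2l lerN2 -lee_fin fineK//.
by under eq_bigr do rewrite ch; exact: S_le.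
Qed.

Hypothesis e_complete : forall h, L2 h -> (forall i, coef h i = 0) ->
  {ae mu, forall x, h x = 0}.

Lemma coef_inj h k : L2 h -> L2 k -> (forall i, coef h i = coef k i) ->
  {ae mu, forall x, h x = k x}.
Proof.
move=> h2 k2 hk; have : {ae mu, forall x, h x - k x = 0}.
  apply: e_complete => [|i]; first exact: L2B.
  by rewrite (coefB em e1)// hk subrr.
by apply: filterS => x /subr0_eq.
Qed.

(** The function that the Riesz-Fischer theorem builds from the coefficients of
    [h] has the same coefficients as [h], hence is [h] by completeness. *)
Lemma parseval h : L2 h -> (sqn h)%:E = sqsum (coef h).
Proof.
move=> h2; have [|k [k2 kh kle]] := @riesz_fischer (coef h).
  by apply: le_lt_trans (bessel_esum h2) _; rewrite ltry.
apply/eqP; rewrite eq_le bessel_esum// andbT; apply: le_trans kle.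
rewrite -!integral_sqmod// (@ge0_ae_eq_integral _ _ _ mu setT _
  (fun x => (sqmod (k x))%:E))//.
- by apply/measurable_EFinP/cmeasurable_sqmod; case: h2.
- by apply/measurable_EFinP/cmeasurable_sqmod; case: k2.
- by move=> x _; rewrite lee_fin sqmod_ge0.
- by move=> x _; rewrite lee_fin sqmod_ge0.
- by apply: filterS (coef_inj h2 k2 (fun i => esym (kh i))) => x -> _.
Qed.

Lemma synth_coef_cvg h (eps : R) : L2 h -> 0 < eps ->
  exists F0 : {fset I}, forall F : {fset I}, (F0 `<=` F)%fset ->
    sqn (fun x => synth F (coef h) x - h x) < eps.
Proof.
move=> h2 eps0; have : ((sqn h - eps)%:E < sqsum (coef h))%E.
  by rewrite -parseval// lte_fin gtrBl.
move=> /lt_esum_fset[F0 F0P]; exists F0 => F F0F.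
rewrite (sqn_synthB em e1 e_orth)//.
rewrite [X in _ + X]big1 ?addr0; last by move=> i _; rewrite subrr sqmod0.
rewrite ltrBlDl -ltrBlDr; apply: lt_le_trans F0P _.
have FF0 : perm_eq [seq i <- F | i \in F0] F0.
  apply: uniq_perm; rewrite ?filter_uniq// => i; rewrite mem_filter.
  by apply/andP/idP => [[]//|iF0]; split => //; exact: (fsubsetP F0F).
rewrite -(perm_big _ FF0)/= big_filter [leRHS](bigID (mem F0))/=.
by rewrite lerDl sumr_ge0// => i _; exact: sqmod_ge0.
Qed.

End CompleteOrthonormalSystem.

(** * Trigonometric integrals on the circle *)

Section CircleIntegrals.
Variable R : realType.
Local Notation circle := (@circle_measure R).

Lemma circle_integral (f F : R -> R) : continuous f ->
  (forall x : R, is_derive x (1 : R) F (f x)) -> (forall x, 0 <= f x) ->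
  (\int[circle]_x (f x)%:E = ((F (2 * pi) - F 0) / (2 * pi))%:E)%E.
Proof.
move=> cf dF f0; have pi2 := @lt0_2pi R.
have mf : measurable_fun setT (EFin \o f).
  by apply/measurable_EFinP; exact: continuous_measurable_fun.
(* uniform_prob is a measure on another instance of the Borel structure of R;
   the circle measure is its image by the identity *)
pose phi : measurableTypeR R -> R := idfun.
have phim : measurable_fun setT phi by move=> _ Y mY; rewrite setTI.
transitivity (\int[pushforward (uniform_prob pi2) phi]_x (f x)%:E)%E => //.
rewrite ge0_integral_pushforward//; last by move=> x _; rewrite lee_fin.
apply: (etrans (integral_uniform pi2 mf (fun x => f0 x))).
have cF x : {for x, continuous F}.
  by apply: differentiable_continuous; apply/derivable1_diffP; case: (dF x).
rewrite (@continuous_FTC2 _ f F)//.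
- by rewrite subr0 -EFinB -EFinM mulrC.
- exact: continuous_subspaceT.
- split.
  + by move=> x _; case: (dF x).
  + by apply: cvg_at_right_filter; exact: cF.
  + by apply: cvg_at_left_filter; exact: cF.
- by move=> x _; rewrite derive1E; apply: derive_val.
Qed.

(** The integral formula for nonnegative functions is applied to [1 + f]. *)
Lemma circle_trig (f F : R -> R) : continuous f ->
  (forall x : R, is_derive x (1 : R) F (f x)) -> (forall x, -1 <= f x <= 1) ->
  F (2 * pi) = F 0 -> \int[circle]_x f x = 0.
Proof.
move=> cf dF f1 F0.
have fi : circle.-integrable setT (EFin \o f).
  apply: (@bounded_integrable _ _ _ circle _ 1) => [|x].
    exact: continuous_measurable_fun.
  by rewrite ler_norml.
have : (\int[circle]_x (1 + f x)%:E = 1)%E.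
  rewrite (@circle_integral _ (fun x => x + F x)).
  - rewrite add0r F0 addrK divff// gt_eqF//; exact: lt0_2pi.
  - by move=> x; apply: cvgD; [exact: cvg_cst|exact: cf].
  - by move=> x; have /andP[+ _] := f1 x; rewrite -lerBlDl sub0r.
under eq_integral do rewrite EFinD.
rewrite integralD//=; last first.
  by apply: (@bounded_integrable _ _ _ circle (fun=> 1) 1) => // x; rewrite normr1.
rewrite integral_cst//= probability_setT mule1 /Rintegral.
have := integrable_fin_num measurableT fi.
case: (integral _ _ _) => // r _ /eqP; rewrite -EFinD eqe -subr_eq0.
by rewrite addrAC subrr add0r => /eqP ->.
Qed.

Lemma cis_int_periodic (k : int) (x : R) : cis (x + k%:~R * (2 * pi)) = cis x.
Proof.
have cis2pi (n : nat) : cis (n%:R * (2 * pi) : R) = 1.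
  elim: n => [|n IH]; first by rewrite mul0r cis0.
  rewrite -natr1 mulrDl mul1r cisD IH mul1r mulr_natl /cis.
  by rewrite cos2pi sin2pi.
rewrite cisD; case: k => n; first by rewrite cis2pi mulr1.
by rewrite NegzE mulrNz mulNr cisN cis2pi conjc1 mulr1.
Qed.

Lemma circle_cis (k : int) : k != 0 -> cint circle (fun x => cis (k%:~R * x)) = 0.
Proof.
move=> k0; have kR : (k%:~R : R) != 0 by rewrite intr_eq0.
have ck : continuous (fun x : R => k%:~R * x).
  by move=> x; apply: cvgM; [exact: cvg_cst|exact: cvg_id].
have dk (x : R) : is_derive x (1 : R) (fun x => k%:~R * x) k%:~R.
  have did := is_derive_id x (1 : R).
  apply: (is_derive_eq (@is_deriveZ _ _ _ (@id R) (k%:~R : R) x 1 1 did)).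
  by rewrite /GRing.scale/= mulr1.
have [c2 s2] : cos (k%:~R * (2 * pi) : R) = 1 /\ sin (k%:~R * (2 * pi) : R) = 0.
  by have := cis_int_periodic k 0; rewrite add0r cis0 => -[].
apply: complex_eqP => /=.
  apply: (@circle_trig _ (fun x => k%:~R^-1 * sin (k%:~R * x))).
  - by move=> x; apply: continuous_comp; [exact: ck|exact: continuous_cos].
  - move=> x; have ds := is_derive1_comp (is_derive_sin (k%:~R * x)) (dk x).
    apply: (is_derive_eq (@is_deriveZ _ _ _ _ (k%:~R^-1 : R) x 1 _ ds)).
    by rewrite /GRing.scale/= mulrC mulfK.
  - by move=> x; rewrite cos_geN1 cos_le1.
  - by rewrite s2 !mulr0 sin0 mulr0.
apply: (@circle_trig _ (fun x => - k%:~R^-1 * cos (k%:~R * x))).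
- by move=> x; apply: continuous_comp; [exact: ck|exact: continuous_sin].
- move=> x; have ds := is_derive1_comp (is_derive_cos (k%:~R * x)) (dk x).
  apply: (is_derive_eq (@is_deriveZ _ _ _ _ (- k%:~R^-1 : R) x 1 _ ds)).
  by rewrite /GRing.scale/= mulrC mulNr mulrNN mulfK.
- by move=> x; rewrite sin_geN1 sin_le1.
- by rewrite c2 mulr0 cos0.
Qed.

Lemma circle_null (B : set R) : measurable B ->
  lebesgue_measure (B `&` `[0, 2 * pi]) = 0%E -> circle B = 0%E.
Proof.
move=> mB B0; rewrite /circle_measure /uniform_prob integral_uniform_pdf.
have mBI : measurable (B `&` `[0, 2 * pi]) by apply: measurableI.
have /null_content_dominatesP := dominates_uniform_prob (@lt0_2pi R).
by apply.
Qed.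

Lemma circle_set1 (b : R) : circle [set b] = 0%E.
Proof.
apply: circle_null => //; apply/eqP; rewrite eq_le measure_ge0 andbT.
have <- := lebesgue_measure_set1 b.
by apply: le_measure; rewrite ?inE//; apply: measurableI.
Qed.

Lemma circle_out : circle (~` `]0, (2 * pi)[) = 0%E.
Proof.
apply: circle_null => //; first exact: measurableC.
apply/eqP; rewrite eq_le measure_ge0 andbT.
have : lebesgue_measure ([set 0 : R] `|` [set 2 * pi]) = 0%E.
  by rewrite null_set_setU//; exact: lebesgue_measure_set1.
move=> <-; apply: le_measure; rewrite ?inE//.
- by apply: measurableI => //; exact: measurableC.
- exact: measurableU.
- move=> x []/=; rewrite !in_itv/= => nx /andP[].
  rewrite !le_eqVlt => /orP[/eqP<-|x0]; first by left.
  by move=> /orP[/eqP->|x1]; [right|exfalso; apply: nx; rewrite x0 x1].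
Qed.

End CircleIntegrals.

(** * Characters of the torus *)

Section ProductIntegral.
Context d1 d2 (T1 : measurableType d1) (T2 : measurableType d2) (R : realType).
Variables (P1 : probability T1 R) (P2 : probability T2 R).
Local Notation Re := (@complex.Re R).
Local Notation Im := (@complex.Im R).

Let fubini_fst (F : T1 * T2 -> R) : measurable_fun setT F ->
  (forall z, `|F z| <= 2) ->
  \int[(P1 \x P2)%E]_z F z = \int[P1]_x \int[P2]_y F (x, y).
Proof.
move=> mF F1.
have iF : (P1 \x P2)%E.-integrable setT (EFin \o F).
  exact: (@bounded_integrable _ _ _ (P1 \x P2)%E _ 2).
rewrite /Rintegral; congr fine; rewrite -integral12_prod_meas1//=.
apply: eq_integral => x _; rewrite fineK//.
apply: integrable_fin_num => //.
apply: (@bounded_integrable _ _ _ P2 (fun y => F (x, y)) 2) => //.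
exact: measurableT_comp.
Qed.

Lemma cint_prod (f : T1 -> R[i]) (g : T2 -> R[i]) :
  cmeasurable f -> cmeasurable g ->
  (forall x, sqmod (f x) <= 1) -> (forall y, sqmod (g y) <= 1) ->
  cint (P1 \x P2)%E (fun z => f z.1 * g z.2) = cint P1 f * cint P2 g.
Proof.
move=> mf mg f1 g1.
have if_ := cintegrable_bounded P1 mf f1.
have ig := cintegrable_bounded P2 mg g1.
have [mr mi] : cmeasurable (fun z : T1 * T2 => f z.1 * g z.2).
  case: mf mg => [mf1 mf2] [mg1 mg2].
  apply: (@cmeasurableM _ _ _ (f \o fst) (g \o snd)); split.
  - exact: (measurableT_comp mf1 measurable_fst).
  - exact: (measurableT_comp mf2 measurable_fst).
  - exact: (measurableT_comp mg1 measurable_snd).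
  - exact: (measurableT_comp mg2 measurable_snd).
have le2 (a b : R) : a ^+ 2 + b ^+ 2 <= 1 -> `|a| <= 2 /\ `|b| <= 2.
  move=> ab; have := sqr_ge0 a; have := sqr_ge0 b => b0 a0.
  by rewrite !ler_norml; split; apply/andP; split; nra.
have fg1 z : sqmod (f z.1 * g z.2) <= 1.
  by rewrite sqmodM mulr_ile1 ?sqmod_ge0.
have inner x : cint P2 (fun y => f x * g y) = f x * cint P2 g by exact: cintZ.
have -> : cint (P1 \x P2)%E (fun z => f z.1 * g z.2) =
    cint P1 (fun x => f x * cint P2 g).
  apply: complex_eqP => /=.
    rewrite fubini_fst// => [|z]; last by case: (le2 _ _ (fg1 z)).
    by apply: eq_Rintegral => x _; rewrite -inner.
  rewrite fubini_fst// => [|z]; last by case: (le2 _ _ (fg1 z)).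
  by apply: eq_Rintegral => x _; rewrite -inner.
under [X in cint _ X]eq_fun do rewrite mulrC.
by rewrite cintZ// mulrC.
Qed.

End ProductIntegral.

Section TorusCharacters.
Variable R : realType.
Local Notation circle := (@circle_measure R).
Local Notation torus := (torus_measure R).

Definition torus_char d (n : 'rV[int]_d) (theta : d.-tuple R) : R[i] :=
  cis (inner_prod (int_vec R n) theta).

Lemma measurable_inner_prod d (x : 'rV[R]_d) : measurable_fun setT (inner_prod x).
Proof.
apply: measurable_sum => i; apply: measurable_funM => //.
exact: measurable_tnth.
Qed.

Lemma cmeasurable_cis d (T : measurableType d) (f : T -> R) :
  measurable_fun setT f -> cmeasurable (fun x => cis (f x)).
Proof.
move=> mf; split; apply: measurableT_comp => //; apply: continuous_measurable_fun.
  exact: continuous_cos.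
exact: continuous_sin.
Qed.

Lemma torus_char_measurable d (n : 'rV[int]_d) :
  cmeasurable (torus_char n : d.-tuple R -> R[i]).
Proof. by apply: cmeasurable_cis; exact: measurable_inner_prod. Qed.

Lemma sqmod_torus_char d (n : 'rV[int]_d) theta : sqmod (torus_char n theta) = 1.
Proof. exact: sqmod_cis. Qed.

Lemma inner_prodD d (x y : 'rV[R]_d) theta :
  inner_prod (x + y) theta = inner_prod x theta + inner_prod y theta.
Proof.
by rewrite -big_split; apply: eq_bigr => i _; rewrite mxE mulrDl.
Qed.

Lemma inner_prodN d (x : 'rV[R]_d) theta :
  inner_prod (- x) theta = - inner_prod x theta.
Proof. by rewrite -sumrN; apply: eq_bigr => i _; rewrite mxE mulNr. Qed.

Lemma torus_charD d (n k : 'rV[int]_d) theta :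
  torus_char (n + k) theta = torus_char n theta * torus_char k theta.
Proof. by rewrite /torus_char int_vecD inner_prodD cisD. Qed.

Lemma torus_charN d (n : 'rV[int]_d) theta :
  torus_char (- n) theta = conjc (torus_char n theta).
Proof.
rewrite /torus_char -cisN -inner_prodN; congr (cis (inner_prod _ _)).
by rewrite /int_vec raddfN.
Qed.

Lemma torus_char0 d theta : torus_char (0 : 'rV[int]_d) theta = 1.
Proof.
rewrite /torus_char /inner_prod big1 ?cis0// => i _.
by rewrite !mxE mul0r.
Qed.

Lemma cint_torusS d (u : d.+1.-tuple R -> R[i]) : cmeasurable u ->
  (forall theta, sqmod (u theta) <= 1) ->
  cint (torus d.+1) u =
  cint (circle \x torus d)%E (fun z => u (tuple_cons z)).
Proof.
move=> [m1 m2] u1.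
have tm := @measurable_tuple_cons R d.
have [i1 i2] : cintegrable (circle \x torus d)%E (fun z => u (tuple_cons z)).
  apply: cintegrable_bounded => //; split.
  - exact: (measurableT_comp m1 tm).
  - exact: (measurableT_comp m2 tm).
apply: complex_eqP; rewrite /= /Rintegral; congr fine.
  by rewrite integral_distribution//; exact/measurable_EFinP.
by rewrite integral_distribution//; exact/measurable_EFinP.
Qed.

Lemma torus_char_cons d (n : 'rV[int]_d.+1) z :
  torus_char n (tuple_cons z) =
  cis ((n 0 ord0)%:~R * z.1) * torus_char (\row_j n 0 (lift ord0 j)) z.2.
Proof.
rewrite /torus_char -cisD; congr cis; rewrite /inner_prod big_ord_recl mxE.
congr (_ * _ + _).
by apply: eq_bigr => j _; rewrite !mxE tnthS.
Qed.

(** The torus measure is a product and characters are products of characters of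
    the circle; the factor along a coordinate with nonzero frequency integrates
    to zero. *)
Lemma cint_torus_char d (n : 'rV[int]_d) :
  cint (torus d) (torus_char n) = (n == 0)%:R.
Proof.
elim: d n => [|d IH] n.
  have -> : n = 0 by apply/matrixP => i [].
  rewrite eqxx; have -> : torus_char (0 : 'rV[int]_0) = fun=> 1.
    by apply/funext => theta; exact: torus_char0.
  exact: cint_cst.
rewrite cint_torusS; last 2 first.
- exact: torus_char_measurable.
- by move=> theta; rewrite sqmod_torus_char.
under [X in cint _ X]eq_fun do rewrite torus_char_cons.
rewrite (@cint_prod _ _ _ _ _ circle (torus d) (fun x => cis ((n 0 ord0)%:~R * x))).
- rewrite IH; have [n0|n0] := eqVneq (n 0 ord0) 0; last first.
    rewrite circle_cis// mul0r; have [n00|//] := eqVneq n 0.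
    by rewrite n00 mxE eqxx in n0.
  have -> : cint circle (fun x => cis ((n 0 ord0)%:~R * x)) = 1.
    under [X in cint _ X]eq_fun do rewrite n0 mul0r cis0.
    exact: cint_cst.
  rewrite mul1r; congr (_ %:R); congr nat_of_bool.
  apply/eqP/eqP => [nr|->]; last by apply/matrixP => i j; rewrite !mxE.
  apply/matrixP => i j; rewrite (ord1 i) [RHS]mxE.
  have [->//|j0] := eqVneq j ord0.
  have [j' ->] : exists j', j = lift ord0 j'.
    by have [j' ->|jj] := unliftP ord0 j; [exists j'|rewrite jj eqxx in j0].
  by move/matrixP : nr => /(_ 0 j'); rewrite !mxE.
- by apply: cmeasurable_cis; apply: measurable_funM.
- exact: torus_char_measurable.
- by move=> x; rewrite sqmod_cis.
- by move=> x; rewrite sqmod_torus_char.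
Qed.

Lemma torus_char_orth d (n k : 'rV[int]_d) :
  cint (torus d) (fun theta => torus_char n theta * conjc (torus_char k theta)) =
  (n == k)%:R.
Proof.
under [X in cint _ X]eq_fun do rewrite -torus_charN -torus_charD.
by rewrite cint_torus_char subr_eq0.
Qed.

Lemma torus_tnth d (i : 'I_d) (B : set R) : measurable B ->
  torus d [set theta | B (tnth theta i)] = circle B.
Proof.
elim: d i => [[]//|d IH] i mB.
rewrite /= /distribution /pushforward.
have [j ->|->] := unliftP ord0 i.
  rewrite (_ : _ @^-1` _ = setT `*` [set theta : d.-tuple R | B (tnth theta j)]).
    rewrite product_measure1E//.
      have circle1 : circle setT = 1%E by exact: probability_setT.
      by rewrite -[RHS]mul1e -(IH j)//; congr (_ * _)%E.
    rewrite -[X in measurable X]setTI; exact: measurable_tnth.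
  by apply/seteqP; split=> z /=; [rewrite tnthS|rewrite tnthS => -[]].
rewrite (_ : _ @^-1` _ = B `*` setT).
  rewrite product_measure1E//.
  have torus1 : torus d setT = 1%E by exact: probability_setT.
  by rewrite -[RHS]mule1 -torus1.
by apply/seteqP; split=> z /=; [|case].
Qed.

End TorusCharacters.

(** * Completeness of the characters of the torus *)

Section PowerThreshold.
Variable R : realType.

Lemma bernoulli_ge (x : R) (n : nat) : -1 <= x -> 1 + n%:R * x <= (1 + x) ^+ n.
Proof.
move=> x1; elim: n => [|n IH]; first by rewrite mul0r addr0 expr0.
rewrite exprS; apply: (@le_trans _ _ ((1 + x) * (1 + n%:R * x))).
  have n0 : 0 <= n%:R :> R by [].
  rewrite -natr1; have := mulr_ge0 n0 (sqr_ge0 x); nra.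
by rewrite ler_wpM2l// -lerBlDl sub0r.
Qed.

(** These polynomials in [p] switch from 1 to 0 at the threshold 1/2: below it
    they are at least [1 - (2 * p) ^+ n], and above it at most
    [1 / (2 * p) ^+ n], both by Bernoulli's inequality. *)
Lemma power_threshold (p : R) : 0 <= p <= 1 -> p != 2^-1 ->
  (1 - p ^+ n) ^+ (2 ^ n) @[n --> \oo] --> ((p < 2^-1)%R%:R : R).
Proof.
move=> /andP[p0 p1] p2.
have q01 n : 0 <= 1 - p ^+ n by rewrite subr_ge0 exprn_ile1.
have pn0 n : 0 <= p ^+ n by rewrite exprn_ge0.
have q1 n : 1 - p ^+ n <= 1 by rewrite gerBl.
case: ltP => [plt|pge].
  apply: (@squeeze_cvgr _ _ _ _ (fun n => 1 - (2 * p) ^+ n) (fun=> 1)).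
  - apply: nearW => n; apply/andP; split; last by rewrite exprn_ile1.
    apply: le_trans (@bernoulli_ge (- p ^+ n) (2 ^ n) _).
      by rewrite natrX exprMn mulrN.
    by rewrite lerN2 exprn_ile1.
  - rewrite -[X in _ --> X]subr0; apply: cvgB; first exact: cvg_cst.
    apply: cvg_expr; rewrite ger0_norm ?mulr_ge0//; lra.
  - exact: cvg_cst.
have {}pge : 2^-1 < p by rewrite lt_neqAle eq_sym p2.
have p2gt : 1 < 2 * p by lra.
apply: (@squeeze_cvgr _ _ _ _ (fun=> 0) (fun n => (2 * p)^-1 ^+ n)).
- apply: nearW => n; rewrite exprn_ge0//=.
  have pp : 0 < (2 * p) ^+ n by rewrite exprn_gt0//; lra.
  rewrite exprVn -[leRHS]div1r ler_pdivlMr//.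
  apply: (@le_trans _ _ ((1 - p ^+ n) ^+ (2 ^ n) * (1 + p ^+ n) ^+ (2 ^ n))).
    rewrite ler_wpM2l ?exprn_ge0//.
    apply: le_trans (bernoulli_ge (2 ^ n) (_ : -1 <= p ^+ n)).
      by rewrite natrX exprMn lerDr.
    by rewrite (le_trans _ (pn0 n))// lerN10.
  rewrite -exprMn exprn_ile1//; last by have := sqr_ge0 (p ^+ n); nra.
  by rewrite mulr_ge0// addr_ge0.
- exact: cvg_cst.
- apply: cvg_expr; rewrite ger0_norm ?invr_ge0; last lra.
  by rewrite invf_lt1//; lra.
Qed.

(** An arc starting at the base point of the circle is a superlevel set of a
    translate of the cosine. *)
Lemma cos_arc (b x : R) : 0 < b < 2 * pi -> 0 < x < 2 * pi -> x != b ->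
  cos (x - b / 2) != cos (b / 2) /\ (cos (x - b / 2) < cos (b / 2)) = (b < x).
Proof.
move=> /andP[b0 b2] /andP[x0 x2] xb.
have E : cos (x - b / 2) - cos (b / 2) = - (2 * (sin (x / 2) * sin ((x - b) / 2))).
  have -> : x - b / 2 = x / 2 + (x - b) / 2 by lra.
  have -> : b / 2 = x / 2 - (x - b) / 2 by lra.
  by rewrite cosB cosD; ring.
have sx : 0 < sin (x / 2).
  by apply: sin_gt0_pi; apply/andP; split; lra.
rewrite -subr_eq0 -[X in _ /\ X = _]subr_lt0 E oppr_lt0 oppr_eq0.
rewrite 2!mulf_eq0 pnatr_eq0 (gt_eqF sx)/= pmulr_rgt0// pmulr_rgt0//.
have [{}xb|bx|xe] := ltgtP x b; last by rewrite xe eqxx in xb.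
  have : 0 < sin ((b - x) / 2) by apply: sin_gt0_pi; apply/andP; split; lra.
  have -> : (b - x) / 2 = - ((x - b) / 2) by lra.
  by rewrite sinN oppr_gt0 => s0; rewrite lt_eqF//; split => //; rewrite ltNge ltW.
have s0 : 0 < sin ((x - b) / 2) by apply: sin_gt0_pi; apply/andP; split; lra.
by rewrite gt_eqF.
Qed.

End PowerThreshold.

Section Completeness.
Variables (R : realType) (d : nat).
Local Notation mu := (torus_measure R d).
Local Notation T := (d.-tuple R).
Local Notation Re := (@complex.Re R).
Local Notation Im := (@complex.Im R).
Local Notation char := (@torus_char R d).
Implicit Types (u : T -> R[i]) (q : T -> R).

(** Such functions will turn out to vanish almost everywhere. *)
Definition no_coef u := cintegrable mu u /\
  forall n, cint mu (fun x => char n x * u x) = 0.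

Let char_cintegrable n u : cintegrable mu u -> cintegrable mu (fun x => char n x * u x).
Proof.
move=> iu; apply: cintegrableM_bounded => // [|x].
  exact: torus_char_measurable.
by rewrite sqmod_torus_char.
Qed.

Lemma no_coefD u v : no_coef u -> no_coef v -> no_coef (fun x => u x + v x).
Proof.
move=> [iu u0] [iv v0]; split=> [|n]; first exact: cintegrableD.
under [X in cint _ X]eq_fun do rewrite mulrDr.
by rewrite cintD ?u0 ?v0 ?addr0//; exact: char_cintegrable.
Qed.

Lemma no_coefZ c u : no_coef u -> no_coef (fun x => c * u x).
Proof.
move=> [iu u0]; split=> [|n]; first exact: cintegrableZ.
under [X in cint _ X]eq_fun do rewrite mulrCA.
by rewrite cintZ ?u0 ?mulr0//; exact: char_cintegrable.
Qed.

Lemma no_coef_char k u : no_coef u -> no_coef (fun x => char k x * u x).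
Proof.
move=> [iu u0]; split=> [|n]; first exact: char_cintegrable.
by under [X in cint _ X]eq_fun do rewrite mulrA -torus_charD; exact: u0.
Qed.

(** Multipliers form an algebra that contains the cosines of the coordinates and
    is closed under bounded limits; through such limits it reaches indicators of
    sets. *)
Definition multiplier q :=
  forall u, no_coef u -> no_coef (fun x => Complex (q x) 0 * u x).

Lemma multiplierD q r : multiplier q -> multiplier r ->
  multiplier (fun x => q x + r x).
Proof.
move=> mq mr u u0; have := no_coefD (mq u u0) (mr u u0).
congr no_coef; apply/funext => x; rewrite -mulrDl; congr (_ * _).
by apply: complex_eqP; rewrite !ReImE /= ?addr0.
Qed.

Lemma multiplierM q r : multiplier q -> multiplier r ->
  multiplier (fun x => q x * r x).
Proof.
move=> mq mr u u0; have := mq _ (mr u u0).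
congr no_coef; apply/funext => x; rewrite mulrA; congr (_ * _).
by apply: complex_eqP; rewrite !ReImE /=; ring.
Qed.

Lemma multiplier_cst c : multiplier (fun=> c).
Proof. by move=> u; exact: no_coefZ. Qed.

Lemma multiplierX q n : multiplier q -> multiplier (fun x => q x ^+ n).
Proof.
move=> mq; elim: n => [|n IH].
  by under eq_fun do rewrite expr0; exact: multiplier_cst.
by under eq_fun do rewrite exprS; exact: multiplierM.
Qed.

Lemma multiplier_compl q : multiplier q -> multiplier (fun x => 1 - q x).
Proof.
move=> mq.
have := multiplierD (multiplier_cst 1) (multiplierM (multiplier_cst (-1)) mq).
by congr multiplier; apply/funext => x; rewrite mulN1r.
Qed.

Lemma tnth_delta (i : 'I_d) (x : T) :
  inner_prod (int_vec R (delta_mx 0 i)) x = tnth x i.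
Proof.
rewrite /inner_prod (bigD1 i)//= big1 ?addr0 => [|j ji].
  by rewrite !mxE !eqxx mul1r.
by rewrite !mxE (negbTE ji) mul0r.
Qed.

Lemma multiplier_cos (i : 'I_d) (c : R) : multiplier (fun x => cos (tnth x i - c)).
Proof.
move=> u u0; pose e := delta_mx 0 i : 'rV[int]_d.
have := no_coefD (no_coefZ (cis (- c) / 2) (no_coef_char e u0))
  (no_coefZ (cis c / 2) (no_coef_char (- e) u0)).
congr no_coef; apply/funext => x; rewrite torus_charN /torus_char tnth_delta.
rewrite !mulrA -mulrDl; congr (_ * _).
rewrite -cisN mulrAC -cisD (mulrAC (cis c)) -cisD -mulrDl.
have two : (2 : R[i]) = Complex 2 0 by apply: complex_eqP; rewrite !ReImE /=; ring.
rewrite [- c + _]addrC -[c - _]opprB cisN.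
apply: (mulIf (_ : (2 : R[i]) != 0)); first by rewrite pnatr_eq0.
rewrite divfK ?pnatr_eq0// two.
by apply: complex_eqP; rewrite !ReImE /=; ring.
Qed.

Let Rint_limit (v : T -> R) (a_ : nat -> T -> R) (a : T -> R) :
  mu.-integrable setT (EFin \o v) ->
  (forall k, measurable_fun setT (a_ k)) -> measurable_fun setT a ->
  (forall k x, 0 <= a_ k x <= 1) ->
  {ae mu, forall x, a_ ^~ x @ \oo --> a x} ->
  (forall k, \int[mu]_x (a_ k x * v x) = 0) -> \int[mu]_x (a x * v x) = 0.
Proof.
move=> iv ma_ ma a01 aa av0.
have vm : measurable_fun setT v by apply/measurable_EFinP; exact: measurable_int iv.
have av k x : `|a_ k x * v x| <= `|v x|.
  have /andP[a0 a1] := a01 k x.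
  by rewrite normrM (ger0_norm a0) ler_piMl.
have iav k : mu.-integrable setT (EFin \o (fun x => a_ k x * v x)).
  apply: (integrable_dominated _ _ (av k)).
    exact: measurable_funM.
  exact: integrable_norm.
have m1 k : measurable_fun setT (fun x => (a_ k x * v x)%:E).
  exact: measurable_int (iav k).
have m2 : measurable_fun setT (fun x => (a x * v x)%:E).
  by apply/measurable_EFinP; exact: measurable_funM.
have cc : {ae mu, forall x, setT x ->
    (fun k => (a_ k x * v x)%:E) @ \oo --> (a x * v x)%:E}.
  apply: filterS aa => x ax _; apply: cvg_EFin; first exact: nearW.
  by apply: cvgM; [exact: ax|exact: cvg_cst].
have dd : {ae mu, forall x k, setT x -> (`|(a_ k x * v x)%:E| <= `|v x|%:E)%E}.
  by apply: aeW => x k _; rewrite lee_fin.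
have [_ _ cv] :=
  dominated_convergence measurableT m1 m2 cc (integrable_norm iv) dd.
have E : (\int[mu]_x (a x * v x)%:E = 0)%E.
  apply: (cvg_unique _ cv) => //.
  rewrite (_ : [sequence _]_n = fun=> 0%E); first exact: cvg_cst.
  apply/funext => k /=; rewrite -(fineK (integrable_fin_num measurableT (iav k))).
  by congr EFin; exact: av0.
by rewrite /Rintegral E.
Qed.

(** Bounded pointwise limits of multipliers are multipliers, by dominated
    convergence. *)
Lemma multiplier_limit (q_ : nat -> T -> R) q :
  (forall k, measurable_fun setT (q_ k)) -> measurable_fun setT q ->
  (forall k x, 0 <= q_ k x <= 1) -> (forall x, 0 <= q x <= 1) ->
  {ae mu, forall x, q_ ^~ x @ \oo --> q x} ->
  (forall k, multiplier (q_ k)) -> multiplier q.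
Proof.
move=> mq_ mq q_01 q01 qq qm u u0; have [iu _] := u0.
split=> [|n].
  apply: cintegrableM_bounded => // x.
  have /andP[q0 q1] := q01 x.
  by rewrite /sqmod/= expr0n addr0 exprn_ile1.
have [i1 i2] := char_cintegrable n iu.
have E r : cint mu (fun x => char n x * (Complex (r x) 0 * u x)) =
    Complex (\int[mu]_x (r x * Re (char n x * u x)))
            (\int[mu]_x (r x * Im (char n x * u x))).
  by apply: complex_eqP => /=; apply: eq_Rintegral => x _; rewrite !ReImE/=; ring.
rewrite E; apply: complex_eqP => /=.
  apply: (Rint_limit i1 mq_) => // k.
  by have [_ /(_ n)] := qm k u u0; rewrite E => -[].
apply: (Rint_limit i2 mq_) => // k.
by have [_ /(_ n)] := qm k u u0; rewrite E => -[].
Qed.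

Let indic01 (S : set T) x : 0 <= (\1_S x : R) <= 1.
Proof. by rewrite indicE; case: (_ \in _); rewrite ?lexx ?ler01. Qed.

Lemma multiplier_ae q (r : T -> R) : measurable_fun setT q -> measurable_fun setT r ->
  (forall x, 0 <= q x <= 1) -> (forall x, 0 <= r x <= 1) ->
  {ae mu, forall x, q x = r x} -> multiplier q -> multiplier r.
Proof.
move=> mq mr q01 r01 qr qm; apply: (@multiplier_limit (fun=> q)) => //.
by apply: filterS qr => x ->; exact: cvg_cst.
Qed.

Definition multiplier_set (S : set T) := measurable S /\ multiplier (\1_S : T -> R).

(** Intersections correspond to products of indicators, and countable unions
    are bounded limits of finite ones. *)
Lemma multiplier_set_algebra : sigma_algebra setT multiplier_set.
Proof.
have mC S : multiplier_set S -> multiplier_set (~` S).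
  move=> [mS mm]; split; first exact: measurableC.
  have := multiplier_compl mm; congr multiplier; apply/funext => x.
  by rewrite !indicE in_setC; case: (_ \in _); rewrite ?subrr ?subr0.
have mI S S' : multiplier_set S -> multiplier_set S' -> multiplier_set (S `&` S').
  move=> [mS mm] [mS' mm']; split; first exact: measurableI.
  by rewrite indicI; exact: multiplierM.
have S0 : multiplier_set set0.
  split => //; rewrite indic0; exact: multiplier_cst.
have mU S S' : multiplier_set S -> multiplier_set S' -> multiplier_set (S `|` S').
  by move=> h h'; rewrite -[_ `|` _]setCK setCU; apply: (mC); apply: mI; exact: mC.
split => //; first by move=> A hA; rewrite setTD; exact: mC.
move=> F hF; pose G n := \bigcup_(k < n) F k.
have hG n : multiplier_set (G n).
  rewrite /G bigcup_mkord; elim: n => [|n IH]; first by rewrite big_ord0.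
  by rewrite big_ord_recr/=; exact: mU.
split; first by apply: bigcupT_measurable => k; case: (hF k).
apply: (@multiplier_limit (fun n => \1_(G n))) => //.
- by move=> n; apply: measurable_indic; case: (hG n).
- by apply: measurable_indic; apply: bigcupT_measurable => k; case: (hF k).
- apply: aeW => x; have [[k _ Fx]|nF] := pselect ((\bigcup_k F k) x).
    apply: cvg_near_cst; exists k.+1 => // n /= kn.
    by rewrite !indicE !mem_set//; [exists k|exists k].
  apply: cvg_near_cst; apply: nearW => n.
  rewrite !indicE memNset; last by move=> [k _ Fx]; apply: nF; exists k.
  by rewrite memNset.
- by move=> n; case: (hG n).
Qed.

Lemma ae_tnth (i : 'I_d) (B : set R) : measurable B -> circle_measure B = 0%E ->
  {ae mu, forall x, ~ B (tnth x i)}.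
Proof.
move=> mB B0; exists [set x | B (tnth x i)]; split.
- by rewrite -[X in measurable X]setTI; exact: measurable_tnth.
- by rewrite torus_tnth.
- by move=> x /= /contrapT.
Qed.

(** The indicator of a half-space is, almost everywhere on the torus, the limit
    of the polynomials of [power_threshold] in a trigonometric polynomial whose
    values cross 1/2 exactly where the coordinate crosses [b]. *)
Lemma multiplier_ray (i : 'I_d) (b : R) :
  multiplier_set ((fun x => tnth x i) @^-1` `]b, +oo[).
Proof.
set S := _ @^-1` _.
have mS : measurable S by rewrite -[X in measurable X]setTI; exact: measurable_tnth.
split => //.
have mi := measurable_indic mS.
have SE x : \1_S x = (b < tnth x i)%R%:R :> R.
  rewrite indicE /S; congr (_ %:R); congr nat_of_bool.
  by apply/idP/idP; rewrite inE /= in_itv/= andbT.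
have inner := @ae_tnth i _ (measurableC (measurable_itv _)) (@circle_out R).
have [b0|b0] := leP b 0.
  apply: (@multiplier_ae (fun=> 1)) => //; first by move=> x; rewrite ler01 lexx.
    apply: filterS inner => x /contrapT; rewrite /= in_itv/= => /andP[x0 _].
    by rewrite SE (le_lt_trans b0 x0).
  exact: multiplier_cst.
have [b2|b2] := leP (2 * pi) b.
  apply: (@multiplier_ae (fun=> 0)) => //; first by move=> x; rewrite ler01 lexx.
    apply: filterS inner => x /contrapT; rewrite /= in_itv/= => /andP[_ x2].
    by rewrite SE ltNge (ltW (lt_le_trans x2 b2)).
  exact: multiplier_cst.
(* the factor 1/4 keeps the values in [0, 1] *)
pose p x : R := 2^-1 + 4^-1 * (cos (tnth x i - b / 2) + - cos (b / 2)).
have pm : multiplier p.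
  apply: multiplierD; first exact: multiplier_cst.
  apply: multiplierM; first exact: multiplier_cst.
  by apply: multiplierD; [exact: multiplier_cos|exact: multiplier_cst].
have p_meas : measurable_fun setT p.
  apply: measurable_funD => //; apply: measurable_funM => //.
  apply: measurable_funD => //.
  apply: measurableT_comp.
    by apply: continuous_measurable_fun; exact: continuous_cos.
  by apply: measurable_funB => //; exact: measurable_tnth.
have p01 x : 0 <= p x <= 1.
  have := cos_le1 (tnth x i - b / 2); have := cos_geN1 (tnth x i - b / 2).
  have := cos_le1 (b / 2); have := cos_geN1 (b / 2).
  by rewrite /p => ? ? ? ?; apply/andP; split; lra.
apply: (@multiplier_limit (fun n x => (1 - p x ^+ n) ^+ (2 ^ n))) => //.
- move=> n; apply: measurable_funX; apply: measurable_funB => //.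
  exact: measurable_funX.
- move=> n x; have /andP[p0 p1] := p01 x.
  have pn0 : 0 <= 1 - p x ^+ n by rewrite subr_ge0 exprn_ile1.
  by rewrite exprn_ge0// exprn_ile1// gerBl exprn_ge0.
- have notb := @ae_tnth i _ (measurable_set1 b) (circle_set1 b).
  apply: filterS2 inner notb => x /contrapT; rewrite /= in_itv/= => x02 /eqP xb.
  have [|ne lt_iff] := @cos_arc _ b _ _ x02 xb; first by rewrite b0 b2.
  rewrite SE -lt_iff.
  have -> : (cos (tnth x i - b / 2) < cos (b / 2)) = (p x < 2^-1).
    by apply/idP/idP; rewrite /p => ?; lra.
  apply: power_threshold => //; apply/eqP => pE.
  by move/eqP : ne; apply; rewrite /p in pE; lra.
- by move=> n; apply/multiplierX/multiplier_compl/multiplierX.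
Qed.

(** The sets whose indicators are multipliers form a sigma-algebra containing
    the half-spaces, hence are all the measurable sets. *)
Lemma multiplier_measurable (S : set T) : measurable S -> multiplier_set S.
Proof.
have [M0 MC MU] := multiplier_set_algebra.
suff : measurable `<=` multiplier_set by apply.
rewrite /measurable/=; apply: smallest_sub; first exact: multiplier_set_algebra.
rewrite -bigcup_seq => S' [i _ [B mB <-]]; rewrite setTI.
suff : (measurable : set (set R)) `<=`
    [set B | multiplier_set ((fun x : T => tnth x i) @^-1` B)] by apply.
rewrite /measurable/= /measurableR RGenOInfty.measurableE.
apply: smallest_sub; last by move=> _ [b ->]; exact: multiplier_ray.
split; first by rewrite /= preimage_set0.
- by move=> A hA; rewrite /= setTD preimage_setC -setTD; exact: MC.
- by move=> A hA; rewrite /= preimage_bigcup; exact: MU.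
Qed.

(** Multiplying [u] by indicators keeps its mean zero, so its integrals over all
    measurable sets vanish. *)
Lemma torus_char_complete u : cintegrable mu u ->
  (forall n, cint mu (fun x => char n x * u x) = 0) -> {ae mu, forall x, u x = 0}.
Proof.
move=> iu u0; have [i1 i2] := iu.
have set_int (P : R[i] -> R) (PZ : forall a z, P (Complex a 0 * z) = a * P z)
    (iP : mu.-integrable setT (fun x => (P (u x))%:E))
    (Pint : forall v, P (cint mu v) = \int[mu]_x P (v x)) :
    {ae mu, forall x, P (u x) = 0}.
  have : ae_eq mu setT (fun x => (P (u x))%:E) (cst 0%E).
    apply: integral_ae_eq => // E _ mE; rewrite integral0.
    have [iE] := (multiplier_measurable mE).2 u (conj iu u0).
    move=> /(_ 0) /(congr1 P).
    under [X in cint _ X]eq_fun do rewrite torus_char0 mul1r.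
    rewrite Pint; under eq_Rintegral do rewrite PZ.
    have -> : P 0 = 0 by have := PZ 0 0; rewrite mulr0 mul0r.
    rewrite integral_mkcond.
    rewrite (_ : _ \_ E = fun x => (\1_E x * P (u x))%:E); last first.
      apply/funext => x; rewrite patchE indicE; case: (x \in E).
        by rewrite mul1r.
      by rewrite mul0r.
    rewrite /Rintegral => fine0.
    rewrite -[LHS]fineK ?fine0//; apply: integrable_fin_num => //.
    apply: (integrable_dominated (w := fun x => `|P (u x)|)).
    - apply: measurable_funM; first exact: measurable_indic.
      by apply/measurable_EFinP; exact: measurable_int iP.
    - exact: integrable_norm.
    - move=> x; have /andP[e0 e1] := indic01 E x.
      by rewrite normrM (ger0_norm e0) ler_piMl.
  by apply: filterS => x /(_ I) [].
have Re0 : {ae mu, forall x, Re (u x) = 0}.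
  by apply: set_int => // a z; rewrite !ReImE/=; ring.
have Im0 : {ae mu, forall x, Im (u x) = 0}.
  by apply: set_int => // a z; rewrite !ReImE/=; ring.
by apply: filterS2 Re0 Im0 => x ux0 ux1; apply: complex_eqP.
Qed.

End Completeness.

(** * Closed walks and minimal forms *)

Section Walks.
Variables (V A : choiceType) (G : graph V A).

Lemma walk_cat u p v q w : walk G u p v -> walk G v q w -> walk G u (p ++ q) w.
Proof. by elim: p u => [u /= ->//|e p IH u /= [-> /IH pw] /pw]. Qed.

Definition reverse_walk (p : seq A) := rev (map (ginv G) p).

Lemma walk_reverse u p v : walk G u p v -> walk G v (reverse_walk p) u.
Proof.
elim: p u => [u /= ->//|e p IH u /= [eu /IH pv]].
rewrite /reverse_walk /= rev_cons -cats1; apply: walk_cat pv _ => /=.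
by rewrite /gtgt ginvK.
Qed.

End Walks.

Section FluxOfWalks.
Variables (R : realType) (d : nat) (V A : finType) (G : graph V A).
Implicit Types (b : A -> 'rV[R]_d) (c : {ffun A -> int}) (p : seq A).

Definition walk_sum (M : zmodType) (b : A -> M) p := \sum_(e <- p) b e.

Lemma walk_sum_reverse (M : zmodType) (b : A -> M) p : one_form G eq b ->
  walk_sum b (reverse_walk G p) = - walk_sum b p.
Proof.
move=> bi; have /permPl pr := perm_rev (map (ginv G) p).
rewrite /walk_sum /reverse_walk (perm_big _ pr) big_map -sumrN.
by apply: eq_bigr => e _; exact: bi.
Qed.

Lemma cycle_antisym c : cycle_space G c -> forall e, c (ginv G e) = - c e.
Proof.
elim=> [v p _ e|c1 c2 _ IH1 _ IH2 e]; first by rewrite !ffunE ginvK opprB.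
by rewrite !ffunE IH1 IH2 opprD.
Qed.

Let half_double (x : 'rV[R]_d) : 2^-1 *: (x + x) = x.
Proof. by rewrite scalerDr -scalerDl -[RHS]scale1r; congr (_ *: _); lra. Qed.

(** Both orientations of an edge contribute the same to the full sum, which,
    unlike the flux, is visibly additive in the cycle. *)
Lemma flux_half b c : one_form G eq b -> (forall e, c (ginv G e) = - c e) ->
  flux b c = 2^-1 *: \sum_e b e *~ c e.
Proof.
move=> bi ci; have -> : \sum_e b e *~ c e = flux b c + flux b c.
  rewrite (bigID (fun e => 0 < c e))/=; congr (_ + _).
  rewrite (bigID (fun e => c e < 0))/= [X in _ + X]big1 ?addr0; last first.
    by move=> e /andP[]; case: ltrgt0P => // ->; rewrite mulr0z.
  rewrite (reindex_inj (inv_inj (ginvK G)))/=.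
  apply: eq_big => e; last by rewrite bi ci mulrNz mulNrz opprK.
  by rewrite ci oppr_gt0 oppr_lt0 -leNgt; case: ltrgt0P.
by rewrite half_double.
Qed.

Lemma flux_chain b p : one_form G eq b -> flux b (chain G p) = walk_sum b p.
Proof.
move=> bi; rewrite flux_half//; last by move=> e; rewrite !ffunE ginvK opprB.
have sum_count (g : A -> 'rV[R]_d) : \sum_e g e *~ (count_mem e p)%:Z = walk_sum g p.
  rewrite /walk_sum; elim: p => [|a p IH].
    by rewrite big_nil big1.
  rewrite big_cons -IH (bigD1 a)//= [in RHS](bigD1 a)//= eqxx PoszD mulrzDr addrA.
  congr (_ + _); apply: eq_bigr => e ea.
  by rewrite eq_sym (negbTE ea).
have -> : \sum_e b e *~ chain G p e = walk_sum b p + walk_sum b p.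
  under eq_bigr do rewrite ffunE mulrzBr.
  rewrite sumrB sum_count; congr (_ + _).
  rewrite (reindex_inj (inv_inj (ginvK G)))/=.
  under eq_bigr do rewrite ginvK bi mulNrz.
  by rewrite sumrN opprK sum_count.
by rewrite half_double.
Qed.

Lemma fluxB b c c' : one_form G eq b -> cycle_space G c -> cycle_space G c' ->
  flux b (c - c') = flux b c - flux b c'.
Proof.
move=> bi cc cc'; rewrite !(@flux_half b)//.
- rewrite -scalerBr -sumrB; congr (_ *: _); apply: eq_bigr => e _.
  by rewrite !ffunE mulrzBr.
- exact: cycle_antisym.
- exact: cycle_antisym.
- exact/cycle_antisym/cycle_sub.
Qed.

Hypothesis G_connected : connected_graph G.

(** A cycle is a single closed walk at any given vertex: closed walks are
    conjugated to [v0], and differences are concatenations with a reversal. The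
    same walk serves all forms. *)
Lemma cycle_walk c (v0 : V) : cycle_space G c -> exists2 p, walk G v0 p v0 &
  forall b, one_form G eq b -> flux b c = walk_sum b p.
Proof.
elim=> [v p pv|c1 c2 c1c [p1 w1 f1] c2c [p2 w2 f2]].
  have [q wq] := G_connected v0 v.
  exists (q ++ p ++ reverse_walk G q).
    exact/(walk_cat wq)/(walk_cat pv)/walk_reverse.
  move=> b bi; rewrite flux_chain// /walk_sum !big_cat/=.
  by rewrite -!/(walk_sum _ _) walk_sum_reverse// addrCA subrr addr0.
exists (p1 ++ reverse_walk G p2); first exact/(walk_cat w1)/walk_reverse.
move=> b bi; rewrite fluxB// f1// f2// /walk_sum big_cat/=.
by rewrite -!/(walk_sum _ _) walk_sum_reverse.
Qed.

(** A minimal form vanishes on a connected spanning subgraph. Otherwise let [K]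
    be a component of the zero set and [e0] an edge leaving [K]; subtracting
    the gradient of [b e0] times the indicator of [K] changes no flux, alters
    [b] only on edges where it is nonzero, and removes [e0] from the support. *)
Lemma minimal_form_zero_walk b u v : minimal_form G eq b ->
  exists2 p, walk G u p v & all (fun e => b e == 0) p.
Proof.
move=> [bi bmin]; apply: contrapT => nuv.
pose K x := `[< exists2 p, walk G u p x & all (fun e => b e == 0) p >].
have Kext e : b e = 0 -> K (gsrc G e) -> K (gtgt G e).
  move=> be0 /asboolP[p wp bp]; apply/asboolP; exists (rcons p e).
    by rewrite -cats1; apply: walk_cat wp _.
  by rewrite all_rcons be0 eqxx.
have Ksym e : b e = 0 -> K (gsrc G e) = K (gtgt G e).
  move=> be0; apply/idP/idP; first exact: Kext.
  rewrite /gtgt => Ki; have := Kext (ginv G e); rewrite /gtgt ginvK; apply => //.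
  by rewrite bi be0 oppr0.
have [e0 [K0 K1]] : exists e0, K (gsrc G e0) /\ ~~ K (gtgt G e0).
  have Ku : K u by apply/asboolP; exists [::].
  have nKv : ~~ K v by apply/asboolP.
  have [p wp] := G_connected u v.
  elim: p {nuv K Kext Ksym}(u) wp (K) Ku nKv => [x /= -> K Kv /negP//|].
  move=> e p IH x /= [ex wp] K Kx nKv.
  have [Ke|nKe] := boolP (K (gtgt G e)); first exact: IH wp K Ke nKv.
  by exists e; rewrite ex.
have be0 : b e0 != 0 by apply: contraNneq K1 => /Ksym <-.
pose b' e := b e - (if K (gsrc G e) then b e0 else 0)
  + (if K (gtgt G e) then b e0 else 0).
have b'i : one_form G eq b'.
  move=> e; rewrite /b' /gtgt ginvK bi; do 2 case: ifP => _;
    by apply/matrixP => i j; rewrite !mxE; ring.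
have walkb' x p y : walk G x p y -> walk_sum b' p =
    walk_sum b p - (if K x then b e0 else 0) + (if K y then b e0 else 0).
  elim: p x => [x /= ->|e p IH x /= [<- /IH]].
    by rewrite /walk_sum !big_nil sub0r addNr.
  rewrite /walk_sum !big_cons => ->; rewrite /b'.
  have telescope (z w k1 k2 k3 : 'rV[R]_d) :
      z - k1 + k2 + (w - k2 + k3) = z + w - k1 + k3.
    by apply/matrixP => i j; rewrite !mxE; ring.
  exact: telescope.
have b'_flux c : cycle_space G c -> flux b' c = flux b c.
  by move=> /(cycle_walk u)[p wp fp]; rewrite !fp// (walkb' _ _ _ wp) subrK.
have := bmin b' b'i b'_flux; apply/negP; rewrite -ltnNge; apply: proper_card.
apply/properP; split.
  apply/fintype.subsetP => e; rewrite !inE; apply: contraNneq => /[dup] be /Ksym Ke.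
  by rewrite /b' be Ke sub0r addNr.
exists e0; rewrite !inE//; apply/negPn.
by rewrite /b' K0 (negbTE K1) subrr addr0.
Qed.

(** Closing an edge by a walk on which the form vanishes makes its value the
    flux of a cycle. *)
Lemma minimal_form_integral b : minimal_form G eq b ->
  (forall c, cycle_space G c -> exists n : 'rV[int]_d, flux b c = int_vec R n) ->
  forall e, exists n, b e = int_vec R n.
Proof.
move=> bmin bint e; have [bi _] := bmin.
have [p wp bp] := minimal_form_zero_walk (gtgt G e) (gsrc G e) bmin.
have [|n fn] := bint (chain G (e :: p)).
  by apply: (@cycle_closed _ _ _ (gsrc G e)) => /=.
exists n; rewrite -fn flux_chain// /walk_sum big_cons big1_seq ?addr0//.
by move=> a /andP[_ ap]; apply/eqP; move/allP : bp; apply.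
Qed.

End FluxOfWalks.

(** * The periodic covering graph *)

(** The covering graph of [G] with deck group [Z ^ d] given by an integral form:
    an edge [a] starting over [n] ends over [n + m a]. *)
Section CoverGraph.
Variables (R : realType) (d : nat) (V A : finType) (G : graph V A).
Variable m : A -> 'rV[int]_d.
Hypothesis m_form : one_form G eq m.
Local Notation Z := 'rV[int]_d.

Definition cover_vert : choiceType := (V * Z)%type.
Definition cover_edge : choiceType := (A * Z)%type.

Definition cover_src (e : cover_edge) : cover_vert := (gsrc G e.1, e.2).
Definition cover_inv (e : cover_edge) : cover_edge := (ginv G e.1, e.2 + m e.1).

Lemma cover_invK : involutive cover_inv.
Proof. by case=> a n; rewrite /cover_inv/= ginvK m_form addrK. Qed.

Lemma cover_inv_neq e : cover_inv e != e.
Proof. by case: e => a n; apply/eqP => -[/eqP]; rewrite (negbTE (ginv_neq G a)). Qed.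

Definition cover_graph : graph cover_vert cover_edge :=
  Graph cover_src cover_invK cover_inv_neq.

Lemma cover_tgt e : gtgt cover_graph e = (gtgt G e.1, e.2 + m e.1).
Proof. by []. Qed.

Lemma cover_walk u p v n : walk G u p v ->
  exists q, walk cover_graph (u, n) q (v, n + walk_sum m p).
Proof.
elim: p u n => [u n /= ->|a p IH u n /= [au wp]].
  by exists [::]; rewrite /walk_sum big_nil /= addr0.
have [q wq] := IH _ (n + m a) wp.
exists ((a, n) :: q); split; first by rewrite /= /cover_src/= au.
by rewrite cover_tgt /walk_sum big_cons addrA.
Qed.

(** From [(u, n)] to [(v, n')]: go to [v0], run a loop with the missing
    translation, go to [v]. *)
Lemma cover_connected (v0 : V) : connected_graph G ->
  (forall n, exists2 p, walk G v0 p v0 & walk_sum m p = n) ->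
  connected_graph cover_graph.
Proof.
move=> conn loops [u n] [v n'].
have [p wp] := conn u v0; have [q wq] := conn v0 v.
have [l wl ml] := loops (n' - n - walk_sum m p - walk_sum m q).
have [r wr] := cover_walk n (walk_cat wp (walk_cat wl wq)).
exists r; move: wr; rewrite /walk_sum !big_cat/= -!/(walk_sum _ _) ml.
congr walk; congr pair; move: (walk_sum m p) (walk_sum m q) => x y.
by apply/matrixP => i j; rewrite !mxE; ring.
Qed.

(** Distinct vertices are placed at distinct points of the half-open diagonal of
    the unit cube, so that the cell vertices are those over [n = 0]. *)
Definition offset (v : V) : R := (enum_rank v)%:R / #|V|%:R.

Lemma offset01 v : 0 <= offset v < 1.
Proof.
have V0 : (0 < #|V|)%N by apply/card_gt0P; exists v.
rewrite divr_ge0//= ltr_pdivrMr ?ltr0n// mul1r ltr_nat; exact: ltn_ord.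
Qed.

Lemma offset_inj : injective offset.
Proof.
move=> v w; have V0 : (0 < #|V|)%N by apply/card_gt0P; exists v.
have V0R : (#|V|%:R : R) != 0 by rewrite pnatr_eq0 -lt0n.
by move=> /(divIf V0R)/eqP; rewrite eqr_nat => /eqP/ord_inj/enum_rank_inj.
Qed.

Definition cover_pos (x : cover_vert) : 'rV[R]_d :=
  int_vec R x.2 + const_mx (offset x.1).

Hypothesis d_gt0 : (0 < d)%N.

Lemma cover_pos_inj : injective cover_pos.
Proof.
move=> [v n] [w k] vw.
have nk j : n 0 j = k 0 j /\ offset v = offset w.
  move/matrixP/(_ 0 j) : vw; rewrite !mxE /= => vw.
  have /andP[v0 v1] := offset01 v; have /andP[w0 w1] := offset01 w.
  suff nk : n 0 j = k 0 j by split => //; move: vw; rewrite nk => /addrI.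
  apply/eqP; rewrite eq_le -!ltzD1 -!(ltr_int R) !intrD; apply/andP.
  by split; rewrite /=; lra.
have -> : v = w by apply: offset_inj; case: (nk (Ordinal d_gt0)).
by congr pair; apply/matrixP => i j; rewrite (ord1 i); case: (nk j).
Qed.

Definition slope (a : A) : R := (enum_rank a)%:R.

(** Edges with the same end points, and the two orientations of a loop, must be
    drawn differently. The correction to the straight segment vanishes at both
    ends and is compatible with reversal, and its slopes at the ends identify
    the oriented edge. *)
Definition bump (a : A) (t : R) : R :=
  t * (1 - t) * ((1 - t) * slope a + t * slope (ginv G a)).

Definition cover_curve (e : cover_edge) (t : R) : 'rV[R]_d :=
  (1 - t) *: cover_pos (cover_src e) + t *: cover_pos (gtgt cover_graph e)
  + bump e.1 t *: const_mx 1.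

Lemma cover_curve_continuous e : {within `[0, 1], continuous (cover_curve e)}.
Proof.
apply: continuous_subspaceT => t.
have ct : continuous (fun t : R => t) by move=> x; exact: cvg_id.
have c1 : continuous (fun t : R => 1 - t).
  by move=> x; apply: cvgB; [exact: cvg_cst|exact: cvg_id].
have cb : continuous (bump e.1).
  by move=> x; apply: cvgM; [apply: cvgM; [exact: ct|exact: c1]|];
    apply: cvgD; apply: cvgM; (exact: c1 || exact: ct || exact: cvg_cst).
apply: cvgD; [apply: cvgD|]; apply: cvgZr_tmp; [exact: c1|exact: ct|exact: cb].
Qed.

Lemma cover_curve_src e : cover_curve e 0 = cover_pos (cover_src e).
Proof. by rewrite /cover_curve /bump subr0 scale1r !mul0r !scale0r !addr0. Qed.

Lemma cover_curve_inv e t : 0 <= t <= 1 ->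
  cover_curve (cover_inv e) t = cover_curve e (1 - t).
Proof.
move=> _; rewrite /cover_curve /gtgt/= cover_invK subKr.
congr (_ + _); first by rewrite addrC.
by congr (_ *: _); rewrite /bump ginvK; ring.
Qed.

Lemma cover_curve_inj e e' : (forall t, 0 <= t <= 1 ->
  cover_curve e t = cover_curve e' t) -> e = e'.
Proof.
move=> ee'.
have src_eq : cover_src e = cover_src e'.
  by apply: cover_pos_inj; rewrite -!cover_curve_src ee'// lexx ler01.
have tgt_eq : gtgt cover_graph e = gtgt cover_graph e'.
  have inv_src x : cover_curve x 1 = cover_pos (gtgt cover_graph x).
    have -> : cover_curve x 1 = cover_curve (cover_inv x) 0.
      by rewrite cover_curve_inv ?subr0// lexx ler01.
    exact: cover_curve_src.
  by apply: cover_pos_inj; rewrite -!inv_src ee'// lexx ler01.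
have bump_eq t : 0 <= t <= 1 -> bump e.1 t = bump e'.1 t.
  move=> /ee'; rewrite /cover_curve src_eq tgt_eq => /addrI /matrixP.
  by move=> /(_ 0 (Ordinal d_gt0)); rewrite !mxE !mulr1.
case: e e' src_eq bump_eq {ee' tgt_eq} => [a n] [a' n'] [_ ->] /= bb.
congr pair; apply: enum_rank_inj; apply: ord_inj; apply/eqP.
rewrite -(eqr_nat R) -![_%:R]/(slope _); apply/eqP.
(* two interior times determine the linear factor of the correction *)
have b1 : bump a (1 / 3) = bump a' (1 / 3) by apply: bb; lra.
have b2 : bump a (2 / 3) = bump a' (2 / 3) by apply: bb; lra.
by move: b1 b2; rewrite /bump; lra.
Qed.

Definition cover_vshift (n : Z) (x : cover_vert) : cover_vert := (x.1, x.2 + n).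
Definition cover_eshift (n : Z) (e : cover_edge) : cover_edge := (e.1, e.2 + n).

Lemma cover_vshiftE n x :
  cover_pos (cover_vshift n x) = cover_pos x + int_vec R n *m 1%:M.
Proof. by rewrite mulmx1 /cover_pos/= int_vecD addrAC. Qed.

Lemma cover_eshiftE n e t : 0 <= t <= 1 ->
  cover_curve (cover_eshift n e) t = cover_curve e t + int_vec R n *m 1%:M.
Proof.
move=> _; rewrite mulmx1 /cover_curve !cover_tgt /cover_src /cover_pos /=.
rewrite !int_vecD; move: (int_vec R e.2) (int_vec R n) (int_vec R (m e.1)) => x y z.
by apply/matrixP => i j; rewrite !mxE; ring.
Qed.

Lemma cover_infinite (v0 : V) : infinite_set [set: cover_vert].
Proof.
move=> finV; apply: infinite_nat.
pose j0 := Ordinal d_gt0.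
pose f (x : cover_vert) := absz (x.2 0 j0).
apply: sub_finite_set (finite_image f finV) => k _.
by exists (v0, const_mx k%:Z) => //; rewrite /f/= mxE.
Qed.

Lemma cover_locally_finite x : finite_set [set e | cover_src e = x].
Proof.
apply: (@sub_finite_set _ _ ((fun a => (a, x.2) : cover_edge) @` setT)).
  by move=> [a n] /= <-; exists a.
by apply: finite_image; exact: finite_finset.
Qed.

Variable v0 : V.
Hypothesis G_connected : connected_graph G.
Hypothesis loops : forall n, exists2 p, walk G v0 p v0 & walk_sum m p = n.

Definition cover_lattice_graph : lattice_graph R d :=
  @LatticeGraph R d cover_vert cover_edge cover_graph 1%:M (unitmx1 _ _)
    cover_pos cover_pos_inj cover_curve cover_curve_continuous cover_curve_src
    cover_curve_inv cover_curve_inj cover_vshift cover_vshiftE cover_eshift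
    cover_eshiftE (cover_connected G_connected loops) (cover_infinite v0)
    cover_locally_finite.

Local Notation P := cover_lattice_graph.

Lemma cover_vclass v n : vclass ((v, n) : lg_vert P) = vclass ((v, 0) : lg_vert P).
Proof. by apply/esym/vclass_eq; exists n; rewrite /= /cover_vshift/= add0r. Qed.

Lemma cover_eclass a n : eclass ((a, n) : lg_edge P) = eclass ((a, 0) : lg_edge P).
Proof. by apply/esym/eclass_eq; exists n; rewrite /= /cover_eshift/= add0r. Qed.

Lemma cover_finite_vert : finite_set [set: fund_vert P].
Proof.
apply: (@sub_finite_set _ _ ((fun v => vclass ((v, 0) : lg_vert P)) @` setT)).
  move=> x _; rewrite -(vreprK x); case: (vrepr x) => v n; exists v => //.
  by rewrite cover_vclass.
by apply: finite_image; exact: finite_finset.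
Qed.

Lemma cover_finite_edge : finite_set [set: fund_edge P].
Proof.
apply: (@sub_finite_set _ _ ((fun a => eclass ((a, 0) : lg_edge P)) @` setT)).
  move=> x _; rewrite -(ereprK x); case: (erepr x) => a n; exists a => //.
  by rewrite cover_eclass.
by apply: finite_image; exact: finite_finset.
Qed.

Definition cover_periodic_graph : periodic_graph R d :=
  PeriodicGraph cover_finite_vert cover_finite_edge.

Let iso_vK : cancel (fun v => vclass ((v, 0) : lg_vert P))
  (fun x : fund_vert P => (vrepr x : cover_vert).1).
Proof.
move=> v; have /vclass_eq[n] := vreprK (vclass ((v, 0) : lg_vert P)).
by move=> /(congr1 fst) /= <-.
Qed.

Let iso_vinvK : cancel (fun x : fund_vert P => (vrepr x : cover_vert).1)
  (fun v => vclass ((v, 0) : lg_vert P)).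
Proof.
move=> x; rewrite -[RHS]vreprK; case: (vrepr x) => v n.
by rewrite cover_vclass.
Qed.

Let iso_eK : cancel (fun a => eclass ((a, 0) : lg_edge P))
  (fun x : fund_edge P => (erepr x : cover_edge).1).
Proof.
move=> a; have /eclass_eq[n] := ereprK (eclass ((a, 0) : lg_edge P)).
by move=> /(congr1 fst) /= <-.
Qed.

Let iso_einvK : cancel (fun x : fund_edge P => (erepr x : cover_edge).1)
  (fun a => eclass ((a, 0) : lg_edge P)).
Proof.
move=> x; rewrite -[RHS]ereprK; case: (erepr x) => a n.
by rewrite cover_eclass.
Qed.

Let iso_srcE a : gsrc (fundamental_graph P) (eclass ((a, 0) : lg_edge P)) =
  vclass ((gsrc G a, 0) : lg_vert P).
Proof. exact: fund_srcE. Qed.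

Let iso_invE a : ginv (fundamental_graph P) (eclass ((a, 0) : lg_edge P)) =
  eclass ((ginv G a, 0) : lg_edge P).
Proof. by apply: (etrans (fund_invE _)); exact: cover_eclass. Qed.

Definition cover_iso : graph_iso G (fundamental_graph cover_periodic_graph) :=
  GraphIso (G' := fundamental_graph cover_periodic_graph)
    iso_vK iso_vinvK iso_eK iso_einvK iso_srcE iso_invE.

Lemma cover_cell v : cell_of cover_iso v = (v, 0).
Proof.
apply/esym/cell_vertexP; split => //=.
exists (cover_pos (v, 0)); last by rewrite mulmx1.
move=> i /=; rewrite !mxE add0r; exact: offset01.
Qed.

Lemma cover_lift (phi : A -> R) a n :
  @lift_form _ _ _ _ _ _ cover_iso phi ((a, n) : lg_edge P) = phi a.
Proof. by rewrite /lift_form /= cover_eclass iso_eK. Qed.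

End CoverGraph.

(** * The Gelfand transform as a Fourier series *)

Section GelfandCoefficients.
Variables (R : realType) (d : nat) (V : finType).
Variables (P : periodic_graph R d) (cell : V -> lg_vert P).
Local Notation Z := 'rV[int]_d.
Local Notation mu := (torus_measure R d).
Local Notation T := (d.-tuple R).
Local Notation char := (@torus_char R d).
Local Notation sqn := (sqn mu).
Implicit Types (g h : T -> V -> R[i]) (f : lg_vert P -> R[i]).

Let char_meas n := @torus_char_measurable R d n.
Let char1 n x := @sqmod_torus_char R d n x.
Let char_orth n k := @torus_char_orth R d n k.

Definition tcoef h v n : R[i] := coef mu char (fun x => h x v) n.

Let char_complete (u : T -> R[i]) : L2 mu u -> (forall n, coef mu char u n = 0) ->
  {ae mu, forall x, u x = 0}.
Proof. by move=> u2; apply: torus_char_complete; exact: L2_cintegrable. Qed.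

Lemma torus_sqnorm_sum h : measurable_field h ->
  torus_sqnorm h = (\sum_v \int[mu]_x (sqmod (h x v))%:E)%E.
Proof.
move=> mh; rewrite /torus_sqnorm; under eq_integral do rewrite -sumEFin.
rewrite ge0_integral_sum// => [v|v x _].
  by apply/measurable_EFinP/cmeasurable_sqmod; case: (mh v).
by rewrite lee_fin sqmod_ge0.
Qed.

Lemma torus_L2P h : torus_L2 h <-> forall v, L2 mu (fun x => h x v).
Proof.
split=> [[mh hoo] v|h2].
  split; first exact: mh.
  apply: le_lt_trans hoo; rewrite torus_sqnorm_sum// (bigD1 v)//= leeDl//.
  by apply: sume_ge0 => w _; apply: integral_ge0 => x _; rewrite lee_fin sqmod_ge0.
have mh : measurable_field h by move=> v; case: (h2 v).
split => //; rewrite torus_sqnorm_sum//.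
under eq_bigr do rewrite integral_sqmod//.
by rewrite sumEFin ltry.
Qed.

Lemma torus_sqnormE h : torus_L2 h ->
  torus_sqnorm h = (\sum_v sqn (fun x => h x v))%:E.
Proof.
move=> /[dup] [[mh _]] /torus_L2P h2; rewrite torus_sqnorm_sum// -sumEFin.
by apply: eq_bigr => v _; rewrite integral_sqmod.
Qed.

Lemma gelfand_sumE f (F : {fset Z}) x v :
  gelfand_sum cell f F x v = synth char F (fun n => f (lg_vshift n (cell v))) x.
Proof. by apply: eq_bigr => n _; rewrite cisN. Qed.

(** The Gelfand transform is the synthesis of Fourier series, so inverting it
    amounts to taking Fourier coefficients. *)
Lemma gelfandP f h : gelfand cell f h <->
  torus_L2 h /\ forall v n, f (lg_vshift n (cell v)) = tcoef h v n.
Proof.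
have diff2 F : torus_L2 h -> torus_L2 (fun x v => gelfand_sum cell f F x v - h x v).
  move=> /torus_L2P h2; apply/torus_L2P => v.
  under eq_fun do rewrite gelfand_sumE.
  by apply: L2B => //; exact: synth_L2.
split=> [[h2 cvg_h]|[h2 fh]].
  split => // v n; apply/eqP; rewrite -subr_eq0; apply/eqP.
  have hv := (torus_L2P h).1 h2 v.
  set z := _ - _; have z0 : sqmod z <= 0.
    rewrite leNgt; apply/negP => /cvg_h[F0 /(_ (F0 `|` [fset n])%fset)].
    rewrite fsubsetUl => /(_ isT); rewrite torus_sqnormE; last exact: diff2.
    rewrite lte_fin ltNge => /negP; apply.
    rewrite (bigD1 v)//=.
    set s := sqn _; apply: (@le_trans _ _ s); last first.
      by rewrite lerDl sumr_ge0// => w _; exact: sqn_ge0.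
    rewrite /s; under eq_fun do rewrite gelfand_sumE.
    apply: (coef_error char_meas char1 char_orth
      (fun n => f (lg_vshift n (cell v)))) => //.
    by rewrite !inE eqxx orbT.
  exact: sqmod_le0.
split => // eps eps0.
have hv v := (torus_L2P h).1 h2 v.
have V0 : 0 < #|V|.+1%:R :> R by rewrite ltr0n.
have eV : 0 < eps / #|V|.+1%:R by rewrite divr_gt0.
have /choice[F0 F0P] v :=
  synth_coef_cvg char_meas char1 char_orth char_complete (hv v) eV.
exists (\bigcup_(v <- enum V) F0 v)%fset => F F0F.
rewrite torus_sqnormE; last exact: diff2.
rewrite lte_fin; apply: (@le_lt_trans _ _ (\sum_(v : V) eps / #|V|.+1%:R)).
  apply: ler_sum => v _; under eq_fun do rewrite gelfand_sumE.
  rewrite (_ : (fun n => _) = tcoef h v); last by apply/funext => n; exact: fh.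
  apply/ltW/F0P; apply: fsubset_trans F0F.
  apply/fsubsetP => n nF0; apply/bigfcupP; exists v => //.
  by rewrite mem_enum.
rewrite sumr_const -[_ *+ _]mulr_natr mulrAC ltr_pdivrMr// ltr_pM2l//.
by rewrite ltr_nat.
Qed.

Lemma cint_ae (u w : T -> R[i]) : cmeasurable u -> cmeasurable w ->
  {ae mu, forall x, u x = w x} -> cint mu u = cint mu w.
Proof.
move=> [u1 u2] [w1 w2] uw; apply: complex_eqP; rewrite /= /Rintegral; congr fine.
  apply: ae_eq_integral => //; try exact/measurable_EFinP.
  by apply: filterS uw => x -> _.
apply: ae_eq_integral => //; try exact/measurable_EFinP.
by apply: filterS uw => x -> _.
Qed.

(* the cell vertices form a fundamental domain for the translations *)
Hypothesis vtx_bij : bijective (fun p : V * Z => lg_vshift p.2 (cell p.1)).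

Lemma esum_vert f : \esum_(x in [set: lg_vert P]) (sqmod (f x))%:E =
  (\sum_(v : V) sqsum (fun n : Z => f (lg_vshift n (cell v))))%E.
Proof.
pose a (v : V) (n : Z) := (sqmod (f (lg_vshift n (cell v))))%:E.
have a0 v n : (0 <= a v n)%E by rewrite lee_fin sqmod_ge0.
transitivity (\esum_(k in [set: V] `*`` (fun=> [set: Z])) a k.1 k.2).
  apply: reindex_esum; have [vinv vinvK vK] := vtx_bij; split => //.
  - by move=> p q _ _ /(can_inj vinvK).
  - by move=> x _; exists (vinv x) => //; exact: vK.
rewrite -esum_esum// esum_fset//; last first.
- by move=> v _; apply: esum_ge0.
- exact: finite_finset.
rewrite -[RHS]big_enum/= [RHS]fsbig_seq ?enum_uniq//; apply: eq_fsbigl.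
by apply/seteqP; split => // v _ /=; rewrite mem_enum.
Qed.

(** Fourier coefficients do not see null sets, and conversely Parseval's
    equality for the components of [g] makes [f] square summable. *)
Lemma gauged_gelfandP f g : gauged_gelfand cell (fun _ _ => 1) f g <->
  torus_L2 g /\ forall v n, f (lg_vshift n (cell v)) = tcoef g v n.
Proof.
split=> [[_ g2 [h /gelfandP[h2 fh] gh]]|[g2 fg]].
  split => // v n; rewrite fh.
  have [hv _] := (torus_L2P h).1 h2 v; have [gv _] := (torus_L2P g).1 g2 v.
  apply: cint_ae; try exact: cmeasurableM.
  by apply: filterS gh => x ->; rewrite mul1r.
have gv := (torus_L2P g).1 g2.
split => //; last first.
  exists g; first exact/gelfandP.
  by apply: aeW => x; apply/funext => v; rewrite mul1r.
rewrite /ell2 esum_vert; under eq_bigr => v _.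
  rewrite (_ : (fun n => _) = tcoef g v); last by apply/funext => n; exact: fg.
  rewrite -(parseval char_meas char1 char_orth char_complete)//.
  over.
by rewrite sumEFin ltry.
Qed.

Lemma gelfand_unitary : unitary (gauged_gelfand cell (fun _ _ => 1)).
Proof.
have [vinv vinvK vK] := vtx_bij.
split.
- move=> f foo.
  have f_v v : (sqsum (fun n : Z => f (lg_vshift n (cell v))) < +oo)%E.
    apply: le_lt_trans foo; rewrite esum_vert (bigD1 v)//= leeDl//.
    by apply: sume_ge0 => w _; apply: esum_ge0 => n _; rewrite lee_fin sqmod_ge0.
  have /choice[h hP] v := riesz_fischer char_meas char1 char_orth (f_v v).
  exists (fun x v => h v x); apply/gauged_gelfandP; split.
    by apply/torus_L2P => v; case: (hP v).
  by move=> v n; have [_ hc _] := hP v; rewrite -hc.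
- move=> f g g' /gauged_gelfandP[g2 fg] /gauged_gelfandP[g'2 fg'].
  have gg' v : {ae mu, forall x, g x v = g' x v}.
    apply: (coef_inj char_meas char1 char_complete).
    + exact: (torus_L2P g).1.
    + exact: (torus_L2P g').1.
    + by move=> n; rewrite -/(tcoef g v n) -fg fg'.
  have : {ae mu, forall x, forall v, v \in enum V -> g x v = g' x v}.
    elim: (enum V) => [|v s IH]; first exact: aeW.
    apply: filterS2 (gg' v) IH => x xv xs w; rewrite inE => /orP[/eqP->//|].
    exact: xs.
  by apply: filterS => x xv; apply/funext => v; apply: xv; rewrite mem_enum.
- move=> f g /gauged_gelfandP[g2 fg]; rewrite torus_sqnormE// esum_vert -sumEFin.
  apply: eq_bigr => v _.
  rewrite (parseval char_meas char1 char_orth char_complete); last first.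
    exact: (torus_L2P g).1.
  by congr sqsum; apply/funext => n; rewrite fg.
- move=> g g2; exists (fun x => tcoef g (vinv x).1 (vinv x).2).
  by apply/gauged_gelfandP; split => // v n; rewrite (vinvK (v, n)).
Qed.

End GelfandCoefficients.

(** * The fiber operator *)

Section FiberOperator.
Variables (R : realType) (d : nat) (V A : finType) (G : graph V A).
Local Notation Z := 'rV[int]_d.
Local Notation mu := (torus_measure R d).

Lemma cis_inner_prod_periodic (n : Z) (t : R) (theta theta' : d.-tuple R) :
  (forall i, eq_mod2pi (tnth theta i) (tnth theta' i)) ->
  cis (t + inner_prod (int_vec R n) theta) =
  cis (t + inner_prod (int_vec R n) theta').
Proof.
move=> /choice[k kP].
have -> : inner_prod (int_vec R n) theta = inner_prod (int_vec R n) theta' +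
    (\sum_i n 0 i * k i)%:~R * (2 * pi).
  rewrite /inner_prod rmorph_sum mulr_suml -big_split; apply: eq_bigr => i _ /=.
  by rewrite kP mxE intrM; ring.
by rewrite addrA cis_int_periodic.
Qed.

(** Multiplication by the character of frequency [m e] shifts the Fourier
    coefficients by [m e]. *)
Lemma tcoef_model (m : A -> Z) (phi : A -> R) (g : d.-tuple R -> V -> R[i]) v n :
  (forall w, L2 mu (fun x => g x w)) ->
  L2 mu (fun x => model_family G (fun e => int_vec R (m e)) phi x (g x) v) /\
  tcoef (fun x => model_family G (fun e => int_vec R (m e)) phi x (g x)) v n =
  (degree G v)%:R * tcoef g v n -
  \sum_(e | gsrc G e == v) cis (phi e) * tcoef g (gtgt G e) (n + m e).
Proof.
move=> g2.
have char2 k h : L2 mu h -> L2 mu (fun x => torus_char k x * h x).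
  move=> h2; apply: L2M_bounded => // [|x]; first exact: torus_char_measurable.
  by rewrite sqmod_torus_char.
pose hop e x := cis (phi e) * (torus_char (m e) x * g x (gtgt G e)).
have hop2 e : L2 mu (hop e) by apply: L2Z; exact: char2.
have E x : model_family G (fun e => int_vec R (m e)) phi x (g x) v =
    (degree G v)%:R * g x v - \sum_(e | gsrc G e == v) hop e x.
  by congr (_ - _); apply: eq_bigr => e _; rewrite cisD -mulrA.
split; first by under eq_fun do rewrite E; apply: L2B; [exact: L2Z|exact: L2_sum].
rewrite /tcoef; under [X in coef _ _ X]eq_fun do rewrite E.
have meas k := @torus_char_measurable R d k.
have sq1 k x := @sqmod_torus_char R d k x.
rewrite (coefB meas sq1)//; [|exact: L2Z|exact: L2_sum].
rewrite (coefZ meas sq1)// (coef_suml meas sq1)//; congr (_ - _).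
apply: eq_bigr => e _; rewrite (coefZ meas sq1)//; last exact: char2.
congr (_ * _); rewrite /coef; congr cint; apply/funext => x.
by rewrite mulrA -torus_charD.
Qed.

Variable m : A -> Z.
Hypothesis m_form : one_form G eq m.
Hypothesis d_gt0 : (0 < d)%N.
Variable v0 : V.
Hypothesis G_connected : connected_graph G.
Hypothesis loops : forall n, exists2 p, walk G v0 p v0 & walk_sum m p = n.
Local Notation P :=
  (@cover_periodic_graph R d V A G m m_form d_gt0 v0 G_connected loops).
Local Notation iso :=
  (@cover_iso R d V A G m m_form d_gt0 v0 G_connected loops).

Lemma cover_magnetic_laplacian (phi : A -> R) (f : lg_vert P -> R[i])
    (v : V) (n : Z) :
  magnetic_laplacian (lift_form iso phi) f (v, n) =
  (degree G v)%:R * f (v, n) -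
  \sum_(e | gsrc G e == v) cis (phi e) * f (gtgt G e, n + m e).
Proof.
pose r : seq (lg_edge P) := [seq (a, n) | a <- [seq a <- enum A | gsrc G a == v]].
pose F (e : lg_edge P) := f (v, n) - cis (lift_form iso phi e) * f (gtgt P e).
rewrite /magnetic_laplacian; transitivity (\sum_(e <- r) F e).
  rewrite [RHS]fsbig_seq; last first.
    by rewrite map_inj_uniq => [|a b []//]; apply: filter_uniq; exact: enum_uniq.
  apply: eq_fsbigl; apply/seteqP; split=> [[a k] /= [av kn]|e /mapP[a + ->]].
    by apply/mapP; exists a; rewrite ?kn// mem_filter mem_enum av eqxx.
  by rewrite mem_filter => /andP[/eqP av _]; rewrite /= /cover_src/= av.
rewrite /r big_map big_filter big_enum_cond/= sumrB sumr_const.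
congr (_ - _).
  rewrite mulr_natl; congr (_ *+ _).
  by rewrite /degree; apply: eq_card => a; rewrite inE.
by apply: eq_bigr => a _; rewrite /F cover_lift.
Qed.

(** The trivial gauge suffices: the cell vertices of the cover are the [(v, 0)],
    so both operators act on coefficients by the same formula. *)
Lemma cover_fiber_operator (phi : A -> R) :
  fiber_operator (cell_of iso) (magnetic_laplacian (lift_form iso phi))
    (model_family G (fun e => int_vec R (m e)) phi).
Proof.
have cellE v n : lg_vshift n (cell_of iso v) = (v, n) :> lg_vert P.
  by rewrite cover_cell /= /cover_vshift/= add0r.
split=> [theta theta' tt'|].
  apply/funext => f; apply/funext => v; congr (_ - _).
  by apply: eq_bigr => e _; rewrite (cis_inner_prod_periodic _ _ tt').
exists (fun _ _ => 1); split.
- split=> [v|theta v]; last exact: sqmod1.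
  exact: cmeasurable_cst.
- apply: gelfand_unitary; exists id => [[v n]|[v n]]; exact: cellE.
- have bij : bijective (fun p : V * Z => lg_vshift p.2 (cell_of iso p.1)).
    by exists id => [[v n]|[v n]]; exact: cellE.
  move=> f g /(gauged_gelfandP bij)[/torus_L2P g2 fg].
  apply/(gauged_gelfandP bij); split.
    by apply/torus_L2P => v; case: (tcoef_model m phi v 0 g2).
  move=> v n; have [_ ->] := tcoef_model m phi v n g2.
  rewrite cellE cover_magnetic_laplacian -fg cellE; congr (_ - _).
  by apply: eq_bigr => e _; rewrite -fg cellE.
Qed.

End FiberOperator.

Theorem corollary2p3 (R : realType) (d : nat) (d_gt0 : (0 < d)%N)
    (V A : finType) (G : graph V A) (G_connected : connected_graph G)
    (m : A -> 'rV[R]_d) (phi : A -> R)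
    (phi_range : forall e, - pi < phi e <= pi)
    (m_minimal : minimal_form G eq m)
    (phi_minimal : minimal_form G (@eq_mod2pi R) phi)
    (m_flux : [set flux m c | c in [set c | cycle_space G c]] =
              range (@int_vec R d)) :
  exists (P : periodic_graph R d) (i : graph_iso G (fundamental_graph P)),
    fiber_operator (cell_of i)
      (magnetic_laplacian (lift_form i phi)) (model_family G m phi).
Proof.
have flux_int c : cycle_space G c -> exists n, flux m c = int_vec R n.
  move=> cc; have : range (@int_vec R d) (flux m c) by rewrite -m_flux; exists c.
  by move=> [n _ <-]; exists n.
have flux_onto n : exists2 c, cycle_space G c & flux m c = int_vec R n.
  have : [set flux m c | c in [set c | cycle_space G c]] (int_vec R n).
    by rewrite m_flux; exists n.
  by move=> [c cc <-]; exists c.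
have [mi mE] := choice (minimal_form_integral G_connected m_minimal flux_int).
have {mE} mE : m = fun e => int_vec R (mi e) by apply/funext.
have int_vec_inj : injective (@int_vec R d).
  move=> n k /matrixP nk; apply/matrixP => i j.
  by have := nk i j; rewrite !mxE => /intr_inj.
have mi_form : one_form G eq mi.
  move=> e; apply: int_vec_inj; have [/(_ e)] := m_minimal.
  by rewrite mE => -> _; rewrite /int_vec raddfN.
have [v0 _] : exists v0 : V, True.
  have [c cc _] := flux_onto 0.
  by elim: cc => [v|//]; exists v.
have loops n : exists2 p, walk G v0 p v0 & walk_sum mi p = n.
  have [c cc fc] := flux_onto n.
  have [p wp fp] := @cycle_walk R d V A G G_connected c v0 cc.
  exists p => //; apply: int_vec_inj.
  rewrite -fc fp; last by case: m_minimal.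
  by rewrite /walk_sum mE /int_vec raddf_sum.
exists (cover_periodic_graph R mi_form d_gt0 G_connected loops).
exists (cover_iso R mi_form d_gt0 G_connected loops).
rewrite mE; exact: cover_fiber_operator.
Qed.
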